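(* Let $0<\epsilon\ll 1$, let $b:\mathbb{R}^n\to\mathbb{R}^n$ be Lipschitz continuous, $\sigma\in\mathbb{R}^{n\times n}$, $T>0$ finite, and let $D\subset\mathbb{R}^n$ be a compact (unsafe) set with boundary $\partial D$. For the system $$dX_t^\epsilon=b(X_t^\epsilon)\,dt+\sqrt{\epsilon}\,\sigma\,dW_t$$ with initial probability measure $\mu(dy)=p_0(y)\,dy$, where $p_0$ is the Gaussian density of $\mathcal{N}(x_0,\Sigma)$, so that $p_0(y)\propto\exp(-S_0(y))$ with $S_0(y)=\tfrac12\|y-x_0\|_\Sigma^2$, the most probable path hitting $\partial D$ (in the low-noise, posterior-mode sense described in the context) is given by the pair $(\hat\phi,\hat t)$ where the minimum of the functional $J_t(\phi)=S_t(\phi)+\epsilon S_0(\phi(0))$ is attained: $$Q'\equiv\inf_{t\le T}\ \min_{\phi:\,\phi(t)\in\partial D}J_t(\phi)=\inf_{t\le T}\ \min_{\phi:\,\phi(t)\in\partial D}\bigl\{S_t(\phi)+\epsilon S_0(\phi(0))\bigr\},$$ where the initial point $\phi(0)\in\mathbb{R}^n$ is unconstrained.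
   Context: $W$ is an $n$-dimensional Wiener process, and $\epsilon$ is a small but finite noise parameter. Paths and action. In the low-noise regime, sample paths are regarded as absolutely continuous functions $\phi$ solving $\dot\phi=b(\phi)+\sigma w$, where $w$ is a measurable $\mathbb{R}^n$-valued function of time representing deviations from the vector field $b$. The action functional is $S_t(\phi)=\tfrac12\int_0^t\|w_s\|^2\,ds$ if $\phi$ is absolutely continuous, and $S_t(\phi)=+\infty$ otherwise. The symbol $S_0$ always denotes the function of a point, $S_0(y)=\tfrac12\|y-x_0\|_\Sigma^2=\tfrac12(y-x_0)^\top\Sigma^{-1}(y-x_0)$, and not the action at $t=0$. Maximum likelihood path and quasi-potential. For a fixed departing point $y$, $$Q(y)=\inf_{t\le T}\ \min_{\phi:\,\phi(0)=y,\ \phi(t)\in\partial D}S_t(\phi),\qquad\text{subject to }\dot\phi=b(\phi)+\sigma w.$$ The solution $(\phi_y^\ast,t_y^\ast)$ is the maximum likelihood path from $y$ hitting $\partial D$ together with its hitting time $t_y^\ast\le T$, so that $Q(y)=S_{t_y^\ast}(\phi_y^\ast)$. Sense of ''most probable''. Let $\tau_D^\epsilon=\inf\{t>0: X^\epsilon_t\in\partial D\}$, and let $p_\epsilon(y\mid \tau_D^\epsilon\le T)$ be the posterior density of $X_0^\epsilon$ given that $\partial D$ is hit by time $T$. By Bayes' theorem and the large deviation principle for small $\epsilon$, $\epsilon\ln p_\epsilon(y\mid\tau_D^\epsilon\le T)$ equals $-Q(y)+o(1)-\epsilon S_0(y)$ up to terms not depending on $y$, where $o(1)$ is the error of the large deviations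 approximation. Omitting this error, the most likely state of departure for small $\epsilon$ is the point $y^\ast$ minimizing $$\Gamma(y)=Q(y)+\epsilon S_0(y),$$ that is, $y^\ast=\arg\max_y p_\epsilon(y\mid\tau_D^\epsilon\le T)\approx\arg\min_y\,(Q(y)+\epsilon S_0(y))$, with accuracy increasing as $\epsilon$ decreases. The most probable path hitting $\partial D$ is understood in this sense: the departing state, the path and the hitting time are determined together, the departing state being the one minimizing $\Gamma$ and the path with its hitting time being the maximum likelihood one from that state. The solution is in general not unique. *)

(* Defs.v *)
From HB Require Import structures.
From mathcomp Require Import all_boot all_order all_algebra.
From mathcomp Require Import all_classical all_reals all_analysis.

Set Implicit Arguments.
Unset Strict Implicit.
Unset Printing Implicit Defensive.

Import Order.TTheory GRing.Theory Num.Theory.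
Import numFieldNormedType.Exports.

Local Open Scope classical_set_scope.
Local Open Scope ring_scope.

Definition boundary (X : topologicalType) (A : set X) : set X :=
  closure A `\` A°.

Definition sqnorm (R : realType) (n : nat) (v : 'cV[R]_n) : R :=
  \sum_i v i 0 ^+ 2.

Definition quadform (R : realType) (n : nat) (A : 'M[R]_n) (v : 'cV[R]_n) : R :=
  (v^T *m A *m v) 0 0.

Definition posdef (R : realType) (n : nat) (A : 'M[R]_n) : Prop :=
  A^T = A /\ forall v : 'cV[R]_n, v != 0 -> 0 < quadform A v.

(* This is S_0, a function of the initial point, not the action at time 0. *)
Definition initial_cost (R : realType) (n : nat) (x0 : 'cV[R]_n)
    (Sigma : 'M[R]_n) (y : 'cV[R]_n) : R :=
  2^-1 * quadform (invmx Sigma) (y - x0).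

Definition gaussian_density (R : realType) (n : nat) (x0 : 'cV[R]_n)
    (Sigma : 'M[R]_n) (y : 'cV[R]_n) : R :=
  (Num.sqrt ((2 * pi) ^+ n * \det Sigma))^-1 *
  expR (- initial_cost x0 Sigma y).

(* The intervals ]l i, r i[ are pairwise disjoint subintervals of [a, b]. *)
Definition absolutely_continuous (R : realType) (V : normedModType R)
    (a b : R) (f : R -> V) : Prop :=
  forall e : R, 0 < e -> exists2 d : R, 0 < d &
  forall (m : nat) (l r : 'I_m -> R),
    (forall i, a <= l i /\ l i <= r i /\ r i <= b) ->
    (forall i j, i != j -> r i <= l j \/ r j <= l i) ->
    \sum_i (r i - l i) < d ->
    \sum_i `|f (r i) - f (l i)| < e.

(* Paths are functions on R of which only the restriction to [0, t] matters. *)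
Definition deviation (R : realType) (n : nat) (b : 'cV[R]_n -> 'cV[R]_n)
    (sigma : 'M[R]_n) (t : R) (phi w : R -> 'cV[R]_n) : Prop :=
  (forall i, measurable_fun `[0, t] (fun s : R => w s i 0)) /\
  {ae (@lebesgue_measure R), forall s : R, s \in `]0, t[ ->
    is_derive s (1 : R) phi (b (phi s) + sigma *m w s)}.

Definition control_cost (R : realType) (n : nat) (t : R)
    (w : R -> 'cV[R]_n) : \bar R :=
  ((2^-1)%:E *
   \int[@lebesgue_measure R]_(s in [set` `[0%R, t]]) (sqnorm (w s))%:E)%E.

(* If sigma is invertible, w is determined almost everywhere by phi; for a
   singular sigma the action is the least cost among the deviations producing
   phi.  It is +oo if there is none. *)
Definition action (R : realType) (n : nat) (b : 'cV[R]_n -> 'cV[R]_n)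
    (sigma : 'M[R]_n) (t : R) (phi : R -> 'cV[R]_n) : \bar R :=
  if `[< absolutely_continuous 0 t phi >] then
    ereal_inf [set control_cost t w | w in deviation b sigma t phi]
  else +oo%E.

(* Both infima are +oo when there is no path to minimise over; t = 0 is allowed,
   so that Q vanishes on the boundary of D. *)
Definition quasi_potential (R : realType) (n : nat)
    (b : 'cV[R]_n -> 'cV[R]_n) (sigma : 'M[R]_n) (T : R)
    (D : set 'cV[R]_n) (y : 'cV[R]_n) : \bar R :=
  ereal_inf [set ereal_inf
    [set action b sigma t phi
    | phi in [set phi : R -> 'cV[R]_n | phi 0 = y /\ boundary D (phi t)]]
  | t in `[0, T]].

Definition max_likelihood_path (R : realType) (n : nat)
    (b : 'cV[R]_n -> 'cV[R]_n) (sigma : 'M[R]_n) (T : R)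
    (D : set 'cV[R]_n) (y : 'cV[R]_n) (phi : R -> 'cV[R]_n) (t : R) : Prop :=
  [/\ 0 <= t <= T, phi 0 = y, boundary D (phi t)
    & action b sigma t phi = quasi_potential b sigma T D y].

Definition Gam (R : realType) (n : nat) (b : 'cV[R]_n -> 'cV[R]_n)
    (sigma : 'M[R]_n) (T : R) (D : set 'cV[R]_n) (x0 : 'cV[R]_n)
    (Sigma : 'M[R]_n) (eps : R) (y : 'cV[R]_n) : \bar R :=
  (quasi_potential b sigma T D y + (eps * initial_cost x0 Sigma y)%:E)%E.

Definition is_argmin (R : realType) (X : Type) (f : X -> \bar R) (x : X) :
    Prop :=
  forall z, (f x <= f z)%E.

Definition is_argmax (R : realType) (X : Type) (f : X -> \bar R) (x : X) :
    Prop :=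
  forall z, (f z <= f x)%E.

(* Bayes' rule for dX = b(X) dt + sqrt eps sigma dW with X_0 of density p0, up
   to normalisation: p0 y times the hitting probability P(tau_D <= T | X_0 = y),
   the latter replaced by its large deviations approximation exp(- Q(y) / eps).
   The weight is 0 where Q is +oo. *)
Definition low_noise_posterior (R : realType) (n : nat)
    (b : 'cV[R]_n -> 'cV[R]_n) (sigma : 'M[R]_n) (T : R) (D : set 'cV[R]_n)
    (p0 : 'cV[R]_n -> R) (eps : R) (y : 'cV[R]_n) : \bar R :=
  ((p0 y)%:E * expeR (- ((eps^-1)%:E * quasi_potential b sigma T D y)))%E.

Definition most_probable_path (R : realType) (n : nat)
    (b : 'cV[R]_n -> 'cV[R]_n) (sigma : 'M[R]_n) (T : R) (D : set 'cV[R]_n)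
    (x0 : 'cV[R]_n) (Sigma : 'M[R]_n) (eps : R)
    (phi : R -> 'cV[R]_n) (t : R) : Prop :=
  exists2 y, is_argmin (Gam b sigma T D x0 Sigma eps) y &
    max_likelihood_path b sigma T D y phi t.

Definition J (R : realType) (n : nat) (b : 'cV[R]_n -> 'cV[R]_n)
    (sigma : 'M[R]_n) (x0 : 'cV[R]_n) (Sigma : 'M[R]_n) (eps : R)
    (t : R) (phi : R -> 'cV[R]_n) : \bar R :=
  (action b sigma t phi + (eps * initial_cost x0 Sigma (phi 0))%:E)%E.

Definition minimal_J (R : realType) (n : nat) (b : 'cV[R]_n -> 'cV[R]_n)
    (sigma : 'M[R]_n) (T : R) (D : set 'cV[R]_n) (x0 : 'cV[R]_n)
    (Sigma : 'M[R]_n) (eps : R) : \bar R :=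
  ereal_inf [set ereal_inf
    [set J b sigma x0 Sigma eps t phi
    | phi in [set phi : R -> 'cV[R]_n | boundary D (phi t)]]
  | t in `[0, T]].

Definition attains_minimal_J (R : realType) (n : nat)
    (b : 'cV[R]_n -> 'cV[R]_n) (sigma : 'M[R]_n) (T : R) (D : set 'cV[R]_n)
    (x0 : 'cV[R]_n) (Sigma : 'M[R]_n) (eps : R)
    (phi : R -> 'cV[R]_n) (t : R) : Prop :=
  [/\ 0 <= t <= T, boundary D (phi t)
    & J b sigma x0 Sigma eps t phi = minimal_J b sigma T D x0 Sigma eps].

(* Main.v *)
Require Import Defs.
From HB Require Import structures.
From mathcomp Require Import all_boot all_order all_algebra.
From mathcomp Require Import all_classical all_reals all_analysis.
From mathcomp.real_closed Require polyrcf.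
From mathcomp Require Import measurable_realfun ring lra.
Import Order.TTheory GRing.Theory Num.Theory.
Import numFieldNormedType.Exports.
Local Open Scope classical_set_scope.
Local Open Scope ring_scope.

Set Implicit Arguments.
Unset Strict Implicit.
Unset Printing Implicit Defensive.

(* Existence is the direct method.  Along a minimising sequence of controlled
   paths the controls are bounded in L^2 and, by Gronwall, the paths are
   uniformly bounded and 1/2-Hoelder.  Limits are taken along one ultrafilter on
   the indices, so that every bounded quantity converges at once and no
   subsequence is extracted.  The controls converge weakly: the limits of their
   integrals over sets form a charge dominated by Lebesgue measure, and the
   limit control is its Radon-Nikodym derivative.  Only the nonlinear drift needs
   strong convergence; writing phi = Z + sigma W with W the primitive of the
   control, the estimate
     |Z r - Z l - (r - l) b(phi l)| <= o(r - l),
   uniform along the sequence, survives pointwise limits and says that the limit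
   of Z is differentiable with derivative b(phi) everywhere.
   The equivalences only rearrange infima: minimising J over all paths is
   minimising over the departing point the infimum over the paths from it. *)

(** * Absolutely continuous functions and their derivatives *)

(** A path solves its equation only almost everywhere, and a null set of times could hide growth, as
    for the Cantor function; [ac_growth] is the mean value inequality that excludes this, and the
    estimates on the drift part go through it. A singular [sigma] does not determine the control
    from the path, so the minimising sequence consists of pairs of a path and a control, and the
    limit control need only be one competitor in the infimum defining the action. The hitting times
    vary along the sequence: controls are extended by zero and paths are stopped at their hitting
    times, which puts them all on [[0, T]]. The departing point is free; what bounds it is the
    Gaussian term, coercive and weighted by [eps > 0]. *)

Lemma real_induction (R : realType) (P : R -> Prop) (a b : R) :
  a <= b -> P a ->
  (forall c, a <= c <= b -> exists2 d : R, 0 < d &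
     forall x y, a <= x <= c -> c <= y <= b -> c - d < x -> y < c + d ->
       P x -> P y) ->
  P b.
Proof.
(* At c = sup A the hypothesis bridges c: a point of A just below c passes P to a point above c,
   contradicting the supremum unless b is within reach. *)
move=> ab Pa step; set A := [set x | a <= x <= b /\ P x].
have Aa : A a by split => //; rewrite lexx.
have supA : has_sup A.
  by split; [exists a|exists b => x [/andP[]]].
have c_ab : a <= sup A <= b.
  apply/andP; split; first exact: sup_upper_bound.
  by apply: ge_sup; [exists a|move=> x [/andP[]]].
have [d d0 dP] := step _ c_ab.
have [x [/andP[ax xb] Px] cx] := sup_adherent d0 supA.
have xc : x <= sup A by apply: sup_upper_bound => //; split=> //; apply/andP.
have [yb|yb] := leP b (sup A + d / 2).
  apply: (dP x) => //; last 1 first.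
  - by apply: le_lt_trans yb _; lra.
  - by rewrite ax.
  - by rewrite lexx andbT; case/andP: c_ab.
have Ay : A (sup A + d / 2).
  case/andP: c_ab => ac cb; split; first by apply/andP; split; lra.
  apply: (dP x) => //; first by rewrite ax.
  - by apply/andP; split; lra.
  - by lra.
by have := sup_upper_bound supA Ay; lra.
Qed.

(** Differentiability without a difference quotient: no division, h = 0 included, so that it can be
    read off from limits of increment estimates. *)
Definition tangent (R : realType) (V : normedModType R) (f : R -> V) (x : R)
    (v : V) : Prop :=
  forall e : R, 0 < e -> exists2 d : R, 0 < d &
    forall h : R, `|h| < d -> `|f (x + h) - f x - h *: v| <= e * `|h|.

Lemma is_derive_tangent (R : realType) (V : normedModType R) (f : R -> V)
    (x : R) (v : V) :
  is_derive x (1 : R) f v <-> tangent f x v.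
Proof.
split=> [[dfx dv] e e0|tg].
  have : (fun h => h^-1 *: ((f \o shift x) (h *: (1 : R)) - f x)) @ 0^' --> v.
    by rewrite -dv; exact: dfx.
  move/cvgrPdist_le => /(_ _ e0); rewrite /= => H.
  have : \forall h \near (0 : R), `|f (x + h) - f x - h *: v| <= e * `|h|.
    move: H; rewrite /dnbhs near_withinE; apply: filterS => h Hh.
    have [->|h0] := eqVneq h 0.
      by rewrite addr0 subrr scale0r subr0 !normr0 mulr0.
    have {Hh} := Hh h0.
    rewrite /= [h *: 1]mulr1 [h + x]addrC distrC => Hh.
    rewrite [X in `|X|](_ : _ = h *: (h^-1 *: (f (x + h) - f x) - v)).
      by rewrite normrZ mulrC ler_pM2r// normr_gt0.
    by rewrite scalerBr scalerA divff// scale1r.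
  move=> /nbhs_ballP[d /= d0 dP]; exists d => // h hd.
  by apply: dP; rewrite /ball/= sub0r normrN.
have : (fun h => h^-1 *: ((f \o shift x) (h *: (1 : R)) - f x)) @ 0^' --> v.
  apply/cvgrPdist_le => e e0; have [d d0 dP] := tg e e0.
  rewrite /dnbhs near_withinE; apply/nbhs_ballP; exists d => //= h.
  rewrite /ball/= sub0r normrN => hd h0.
  rewrite [h *: 1]mulr1 [h + x]addrC distrC.
  rewrite [X in `|X|](_ : _ = h^-1 *: (f (x + h) - f x - h *: v)).
    by rewrite normrZ normfV mulrC ler_pdivrMr ?normr_gt0// dP.
  by rewrite [RHS]scalerBr scalerA mulVf// scale1r.
by move=> H; split; [apply/cvg_ex; exists v|exact: cvg_lim H].
Qed.

Lemma tangentD (R : realType) (V : normedModType R) (f g : R -> V) (x : R)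
    (u v : V) :
  tangent f x u -> tangent g x v -> tangent (fun y => f y + g y) x (u + v).
Proof.
by move=> /is_derive_tangent fu /is_derive_tangent gv; apply/is_derive_tangent.
Qed.

Lemma tangentN (R : realType) (V : normedModType R) (f : R -> V) (x : R)
    (u : V) :
  tangent f x u -> tangent (fun y => - f y) x (- u).
Proof.
by move=> /is_derive_tangent fu; apply/is_derive_tangent.
Qed.

Lemma tangent_mulr (R : realType) (f : R -> R) (x c k : R) :
  tangent f x c -> tangent (fun y => k * f y) x (k * c).
Proof.
by move=> /is_derive_tangent fu; apply/is_derive_tangent.
Qed.

Lemma tangent_linear (R : realType) (V : normedModType R) (x l : R) (v : V) :
  tangent (fun y => (y - l) *: v) x v.
Proof.
move=> e e0; exists 1 => // h _.
by rewrite -scalerBl -scalerBl (_ : _ - h = 0) ?scale0r ?normr0 ?mulr_ge0// ?ltW//; ring.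
Qed.

(** The two increments from c point to opposite sides, so their errors add up to e times the full
    length y - x. *)
Lemma tangent_straddle (R : realType) (V : normedModType R) (f : R -> V)
    (c : R) (v : V) (e : R) :
  tangent f c v -> 0 < e -> exists2 d : R, 0 < d &
    forall x y, x <= c -> c <= y -> c - d < x -> y < c + d ->
      `|f y - f x - (y - x) *: v| <= e * (y - x).
Proof.
move=> tg e0; have [d d0 dP] := tg e e0; exists d => // x y xc cy dx yd.
have /dP : `|y - c| < d by rewrite ger0_norm; lra.
have /dP : `|x - c| < d by rewrite ler0_norm; lra.
rewrite (ler0_norm (_ : x - c <= 0)); last lra.
rewrite (ger0_norm (_ : 0 <= y - c)); last lra.
rewrite !(addrC c) !subrK => H1 H2.
rewrite (_ : f y - f x - _ = (f y - f c - (y - c) *: v) -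
   (f x - f c - (x - c) *: v)); last first.
  rewrite (_ : y - x = (y - c) - (x - c)); last by ring.
  rewrite scalerBl opprB [in RHS]opprB [X in _ = _ + X]addrC [RHS]addrACA.
  by congr (_ + _); [rewrite opprB addrA subrK|rewrite addrC].
by apply: (le_trans (ler_normB _ _)); lra.
Qed.

(* Null sets are absorbed by an open set of small measure, on which absolute
   continuity controls the increments; elsewhere a.e. differentiability does. *)
Lemma ac_growth (R : realType) (V : normedModType R) (a b : R) (g : R -> V)
    (H : R -> R) :
  a <= b -> absolutely_continuous a b g ->
  (forall x y, a <= x -> x <= y -> y <= b -> H x <= H y) ->
  {ae (@lebesgue_measure R), forall s : R, a < s < b ->
     exists v c, [/\ tangent g s v, tangent H s c & `|v| <= c]} ->
  `|g b - g a| <= H b - H a.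
Proof.
move=> ab acg ndH [N [mN N0 NP]].
apply/ler_addgt0Pr => e e0.
(* The tangents of [g] and [H] each cost this slope; twice it over the length b - a stays below e /
   2, and the added 1 covers a = b. *)
have e1_gt0 : 0 < e / (1 + (b - a)) / 4 by rewrite !divr_gt0//; lra.
have [d d0 dP] := acg (e / 2) ltac:(lra).
(* The endpoints join the null set because derivatives are assumed only in the open interval. *)
pose M := N `|` [set a] `|` [set b].
have mM : measurable M by do 2 apply: measurableU => //.
have M0 : lebesgue_measure M = 0%E.
  rewrite !measureU0//; first exact: lebesgue_measure_set1.
  - exact: measurableU.
  - exact: lebesgue_measure_set1.
have [|U [oU MU muU]] := @lebesgue_regularity_outer R M d mM _ d0.
  by rewrite (_ : (_ < _)%E = (lebesgue_measure M < +oo)%E)// M0.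
have mU : measurable U by exact: open_measurable.
have {}muU : (lebesgue_measure U < d%:E)%E.
  rewrite -(setDUK MU) measureU//.
  - by rewrite [X in (X + _)%R](_ : _ = 0%E)// add0e.
  - exact: measurableD.
  - by rewrite setDIK.
have UfinI A : measurable A -> lebesgue_measure (U `&` A) \is a fin_num.
  move=> mA; rewrite ge0_fin_numE//; apply: le_lt_trans (lt_trans muU (ltry d)).
  by apply: le_measure; rewrite ?inE//; apply: measurableI.
pose F x := fine (lebesgue_measure (U `&` `]a, x])).
have FU x y : a <= x -> x <= y ->
    F y = F x + fine (lebesgue_measure (U `&` `]x, y])).
  move=> ax xy; rewrite /F -fineD ?UfinI//.
  rewrite -measureU//; [|exact: measurableI..|].
    rewrite -setIUr; congr (fine (lebesgue_measure (_ `&` _))).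
    apply/seteqP; split=> z /=; rewrite !in_itv/=.
      by move=> /andP[az ->]; case: (leP z x) => zx; [left|right]; rewrite ?az.
    by move=> [/andP[-> zx]|/andP[xz ->]]; lra.
  rewrite setIACA setIid; apply/seteqP; split=> z //= [_ []].
  by rewrite !in_itv/=; lra.
(* Invariant: the increment of g over [a, x] is paid by H, up to a small slope, except on finitely
   many disjoint intervals of total length at most the measure of U below x. Families on [nat] let
   an interval be appended. *)
pose P x := exists (m : nat) (l r : nat -> R),
  [/\ (forall i, (i < m)%N -> a <= l i <= r i /\ r i <= x),
      (forall i j, (i < j < m)%N -> r i <= l j),
      \sum_(i < m) (r i - l i) <= F x &
      `|g x - g a| <= H x - H a + (e / (1 + (b - a)) / 4) * 2 * (x - a) +
         \sum_(i < m) `|g (r i) - g (l i)|].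
suff [m [l [r [lr disj sumF gb]]]] : P b.
  apply: (le_trans gb); rewrite -addrA lerD2l.
  have : \sum_(i < m) `|g (r i) - g (l i)| < e / 2.
    apply: (dP m (fun i => l i) (fun i => r i)).
    - by move=> i; have [/andP[-> ->] ->] := lr _ (ltn_ord i).
    - move=> i j; rewrite -val_eqE neq_ltn => /orP[] ij; [left|right];
      by apply: disj; rewrite ij/=.
    - apply: (le_lt_trans sumF); rewrite -lte_fin fineK ?UfinI//.
      apply: le_lt_trans muU; apply: le_measure; rewrite ?inE//.
      exact: measurableI.
  have : e / (1 + (b - a)) / 4 * 2 * (b - a) <= e / 2.
    have : (b - a) / (1 + (b - a)) <= 1 by rewrite ler_pdivrMr; lra.
    rewrite mulrAC -!mulrA (mulrA _ (b - a)); nra.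
  by lra.
apply: (@real_induction _ P a b ab).
  exists 0%N, (fun=> 0), (fun=> 0); split=> //; rewrite ?big_ord0 ?fine_ge0//.
  by rewrite !subrr normr0 mulr0 !addr0.
move=> c /andP[ac cb].
(* Near a point of M the piece ]x, y] lies in U and becomes the new last interval; elsewhere no
   interval is added and the straddle estimates pay for the increment. *)
have [cM|cM] := pselect (M c).
  have /nbhs_ballP[del /= del0 delU] : nbhs c U.
    by apply: open_nbhs_nbhs; split=> //; exact: MU.
  exists del => // x y /andP[ax xc] /andP[cy yb] cx yc.
  move=> [m [l [r [lr disj sumF gb]]]].
  have xyU : U `&` `]x, y] = `]x, y]%classic.
    apply/seteqP; split=> z /= => [[]//|zxy]; split => //.
    by apply: delU; rewrite /ball/= ltr_distlC; move: zxy; rewrite in_itv/=; lra.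
  exists m.+1, (fun i => if i == m then x else l i),
    (fun i => if i == m then y else r i).
  have sumE (f : R -> R -> R) :
    \sum_(i < m.+1) f (if val i == m then x else l i)
                      (if val i == m then y else r i) =
    \sum_(i < m) f (l i) (r i) + f x y.
    rewrite big_ord_recr/= eqxx; congr (_ + _).
    by apply: eq_bigr => i _; rewrite (ltn_eqF (ltn_ord i)).
  split.
  - move=> i; rewrite ltnS; case: eqP => [_ _|/eqP im im']; first by lra.
    have /lr : (i < m)%N by rewrite ltn_neqAle im.
    by lra.
  - move=> i j /andP[ij]; rewrite ltnS => jm.
    rewrite (ltn_eqF (leq_trans ij jm)).
    case: eqP => [_|/eqP jm']; last by apply: disj; rewrite ij ltn_neqAle jm'.
    by have [] := lr _ (leq_trans ij jm).
  - rewrite (sumE (fun u v => v - u)) (FU x y)//; last lra.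
    rewrite lerD// xyU lebesgue_measure_itv/= lte_fin.
    by case: ltP => /=; lra.
  - rewrite (sumE (fun u v => `|g v - g u|)).
    rewrite (_ : g y - g a = (g x - g a) + (g y - g x)); last first.
      by rewrite [RHS]addrC addrA subrK.
    apply: (le_trans (ler_normD _ _)).
    have : H x <= H y by apply: ndH; lra.
    have : 0 <= (e / (1 + (b - a)) / 4) * 2 * (y - x) by rewrite mulr_ge0//; lra.
    by lra.
have : exists v k, [/\ tangent g c v, tangent H c k & `|v| <= k].
  have : (~` N) c by move=> Nc; apply: cM; left; left.
  move=> nNc; have : a < c < b.
    rewrite !lt_neqAle ac cb !andbT; apply/andP; split; apply/negP => /eqP E.
      by apply: cM; left; right.
    by apply: cM; right.
  by apply: contrapT; move: nNc; apply: contra_not => ?; apply: NP.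
move=> [v [k [gv Hk vk]]].
have [d1 d10 P1] := tangent_straddle gv e1_gt0.
have [d2 d20 P2] := tangent_straddle Hk e1_gt0.
exists (Num.min d1 d2); first by rewrite lt_min d10.
move=> x y /andP[ax xc] /andP[cy yb].
have m1 : Num.min d1 d2 <= d1 by rewrite ge_min lexx.
have m2 : Num.min d1 d2 <= d2 by rewrite ge_min lexx orbT.
move=> cx yc.
move=> [m [l [r [lr disj sumF gb]]]]; exists m, l, r; split => //.
- by move=> i /lr[-> ?]; split => //; lra.
- apply: (le_trans sumF); rewrite (FU x y) ?lerDl ?fine_ge0//; lra.
- have := P1 x y xc cy ltac:(lra) ltac:(lra).
  have := P2 x y xc cy ltac:(lra) ltac:(lra).
  set e1 := e / _ / _ in gb e1_gt0 *.
  rewrite ler_norml => /andP[Hlb _] gub.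
  have : `|g y - g x| <= (y - x) * k + e1 * (y - x).
    rewrite -(subrK ((y - x) *: v) (g y - g x)) addrC.
    apply: (le_trans (ler_normD _ _)); rewrite lerD// normrZ.
    by rewrite ger0_norm ?ler_wpM2l//; lra.
  rewrite (_ : g y - g a = (g x - g a) + (g y - g x)); last first.
    by rewrite [RHS]addrC addrA subrK.
  move=> gxy; apply: (le_trans (ler_normD _ _)).
  move: Hlb; rewrite /GRing.scale/=.
  by nra.
Qed.

(** * Primitives of square-integrable functions *)

(* [R] carries two convertible measurable structures; [measurableTypeR R] is the
   one on which [lebesgue_measure] is declared. *)
Definition sqr_integrable (R : realType) (w : measurableTypeR R -> R) : Prop :=
  measurable_fun setT w /\
  (@lebesgue_measure R).-integrable setT (fun x => (w x ^+ 2)%:E).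

Lemma sqr_integrable_sqr (R : realType) (w : measurableTypeR R -> R)
    (A : set (measurableTypeR R)) :
  sqr_integrable w -> measurable A ->
  (@lebesgue_measure R).-integrable A (EFin \o (fun x => w x ^+ 2)).
Proof. by move=> [_ iw2] mA; exact: integrableS iw2. Qed.

Lemma integrable_cst_lty (R : realType) (A : set (measurableTypeR R)) (k : R) :
  measurable A -> (lebesgue_measure A < +oo)%E ->
  (@lebesgue_measure R).-integrable A (EFin \o cst k).
Proof.
move=> mA fA; apply: measurable_bounded_integrable => //.
by exists `|k|; split => // x kx t _ /=; exact: ltW.
Qed.

(** On a set of finite measure the constant 1 is integrable, and |w| <= 1 + w^2. *)
Lemma sqr_integrable_int (R : realType) (w : measurableTypeR R -> R)
    (A : set (measurableTypeR R)) :
  sqr_integrable w -> measurable A -> (lebesgue_measure A < +oo)%E ->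
  (@lebesgue_measure R).-integrable A (EFin \o w).
Proof.
move=> lw mA fA; have := sqr_integrable_sqr lw mA; case: lw => mw _ iw2.
have i1 : (@lebesgue_measure R).-integrable A (EFin \o cst 1).
  exact: integrable_cst_lty.
apply: (le_integrable mA _ _ (integrableD mA i1 iw2)).
  by apply/measurable_EFinP; exact: measurable_funS mw.
move=> x _ /=; rewrite lee_fin [leRHS]ger0_norm ?addr_ge0 ?sqr_ge0//.
have := sqr_ge0 (`|w x| - 1 / 2); rewrite -(real_normK (num_real (w x))).
by have := sqr_ge0 `|w x|; rewrite !expr2; lra.
Qed.

(** Discriminant form of Cauchy-Schwarz, used both for integrals and for the quadratic form of a
    matrix. *)
Lemma quad_discr (R : realFieldType) (E I m : R) :
  (forall c, 0 <= E - c * 2 * I + c ^+ 2 * m) -> 0 <= m -> I ^+ 2 <= m * E.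
Proof.
move=> H m0; have [m_gt0|] := ltP 0 m.
  have := H (I / m).
  rewrite (_ : _ + _ = (m * E - I ^+ 2) / m); last by field; rewrite gt_eqF.
  by rewrite pmulr_lge0 ?invr_gt0// subr_ge0.
move=> m0'; have {m0 m0'} m_eq0 : m = 0 by apply/eqP; rewrite eq_le m0'.
have [->|I0] := eqVneq I 0; first by rewrite expr0n m_eq0 mul0r.
(* For m = 0 the polynomial is affine in c, and this c gives it the value -1. *)
have := H ((E + 1) / (2 * I)).
rewrite m_eq0 mulr0 addr0 (_ : _ - _ = - 1) ?oppr_ge0 ?ler10//.
by field.
Qed.

Lemma sqr_Rintegral_le (R : realType) (w : measurableTypeR R -> R)
    (A : set (measurableTypeR R)) :
  sqr_integrable w -> measurable A -> (lebesgue_measure A < +oo)%E ->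
  (\int[lebesgue_measure]_(x in A) w x) ^+ 2 <=
  fine (lebesgue_measure A) * \int[lebesgue_measure]_(x in A) (w x ^+ 2).
Proof.
move=> lw mA fA; apply: quad_discr; last exact: fine_ge0.
move=> c.
have iw := sqr_integrable_int lw mA fA.
have iw2 := sqr_integrable_sqr lw mA.
have ic : (@lebesgue_measure R).-integrable A (EFin \o cst (c ^+ 2)).
  exact: integrable_cst_lty.
have icw : (@lebesgue_measure R).-integrable A (EFin \o (fun x => c * 2 * w x)).
  exact: (integrableZl mA (c * 2) iw).
have -> : \int[lebesgue_measure]_(x in A) (w x ^+ 2) -
  c * 2 * \int[lebesgue_measure]_(x in A) w x + c ^+ 2 * fine (lebesgue_measure A)
  = \int[lebesgue_measure]_(x in A) (w x ^+ 2 - c * 2 * w x + c ^+ 2).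
  rewrite RintegralD//; last exact: (integrableB mA iw2 icw).
  by rewrite RintegralB// RintegralZl// Rintegral_cst.
apply: Rintegral_ge0 => x _.
by rewrite (_ : _ + _ = (w x - c) ^+ 2) ?sqr_ge0//; ring.
Qed.

Definition prim (R : realType) (w : measurableTypeR R -> R) (s : R) : R :=
  \int[lebesgue_measure]_(x in `[0, s]) w x.

Lemma itv_lty (R : realType) (a b : R) (p q : bool) :
  (lebesgue_measure [set` Interval (BSide p a) (BSide q b)] < +oo)%E.
Proof. by rewrite lebesgue_measure_itv/=; case: ifP => //; rewrite -EFinD ltry. Qed.

Lemma prim0 (R : realType) (w : measurableTypeR R -> R) : prim w 0 = 0.
Proof. by rewrite /prim set_itv1 Rintegral_set1. Qed.

Lemma primB (R : realType) (w : measurableTypeR R -> R) (l r : R) :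
  sqr_integrable w -> 0 <= l -> l <= r ->
  prim w r - prim w l = \int[lebesgue_measure]_(x in `]l, r]) w x.
Proof.
move=> lw l0 lr; rewrite /prim Rintegral_itvB//.
by apply: sqr_integrable_int => //; exact: itv_lty.
Qed.

(** The energy is kept local to ]l, r], since absolute continuity of the primitive sums it over
    disjoint intervals. *)
Lemma prim_energy (R : realType) (w : measurableTypeR R -> R) (l r : R) :
  sqr_integrable w -> 0 <= l -> l <= r ->
  (prim w r - prim w l) ^+ 2 <=
  (r - l) * \int[lebesgue_measure]_(x in `]l, r]) (w x ^+ 2).
Proof.
move=> lw l0 lr; rewrite primB//.
have := @sqr_Rintegral_le R w `]l, r] lw (measurable_itv _) (itv_lty _ _ _ _).
rewrite lebesgue_measure_itv/= lte_fin; move: lr; rewrite le_eqVlt.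
by case/predU1P => [->|->]; rewrite ?ltxx ?subrr.
Qed.

Lemma le_energy_setT (R : realType) (w : measurableTypeR R -> R)
    (A : set (measurableTypeR R)) :
  sqr_integrable w -> measurable A ->
  \int[lebesgue_measure]_(x in A) (w x ^+ 2) <=
  \int[lebesgue_measure]_x (w x ^+ 2).
Proof.
move=> lw mA; rewrite fine_le//.
- by apply: integrable_fin_num => //; exact: sqr_integrable_sqr.
- by apply: integrable_fin_num => //; case: lw.
- apply: ge0_subset_integral => //.
  + by apply: measurable_int; case: lw => _; exact.
  + by move=> x _; rewrite lee_fin sqr_ge0.
Qed.

Lemma prim_holder (R : realType) (w : measurableTypeR R -> R) (C l r : R) :
  sqr_integrable w -> 0 <= l -> l <= r ->
  \int[lebesgue_measure]_x (w x ^+ 2) <= C ->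
  (prim w r - prim w l) ^+ 2 <= C * (r - l).
Proof.
move=> lw l0 lr wC; apply: (le_trans (prim_energy lw l0 lr)).
rewrite mulrC ler_wpM2r ?subr_ge0//; apply: le_trans wC.
exact: le_energy_setT.
Qed.

Lemma prim_tangent (R : realType) (w : measurableTypeR R -> R) :
  sqr_integrable w ->
  {ae (@lebesgue_measure R), forall s : R, 0 < s -> tangent (prim w) s (w s)}.
Proof.
move=> lw.
have intw y : (@lebesgue_measure R).-integrable
    [set` Interval (BLeft 0) (BRight y)] (EFin \o w).
  by apply: sqr_integrable_int => //; exact: itv_lty.
have locw : locally_integrable setT w.
  case: (lw) => mw _; split => //; first exact: openT.
  move=> K _ cK; have mK : measurable K by exact: compact_measurable.
  have fK : (lebesgue_measure K < +oo)%E.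
    exact: compact_finite_measure.
  by have /integrableP[] := sqr_integrable_int lw mK fK.
have := FTC1 intw locw; apply: filterS.
  exact: (ae_filter_ringOfSetsType lebesgue_measure).
move=> s + s0.
rewrite lte_fin => /(_ s0)[dp <-].
by apply/is_derive_tangent; rewrite derive1E; exact: derivableP.
Qed.

Lemma entry_norm_le (R : realType) (n : nat) (v : 'cV[R]_n) (i : 'I_n) :
  `|v i 0| <= `|v|.
Proof.
by rewrite [leRHS]/Num.Def.normr/= mx_normrE; apply: (le_bigmax _ _ (i, ord0)).
Qed.

Lemma cV_norm_le (R : realType) (n : nat) (v : 'cV[R]_n) (c : R) :
  0 <= c -> (forall i, `|v i 0| <= c) -> `|v| <= c.
Proof.
move=> c0 vc; rewrite [leLHS]/Num.Def.normr/= mx_normrE; apply/bigmax_leP; split=> //.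
by move=> [i j] _ /=; rewrite ord1.
Qed.

(** The norm is the maximum norm, so the sum of all absolute entries suffices; the extra 1 keeps K
    positive for the zero matrix, as K is divided by later. *)
Lemma mulmx_bound (R : realType) (n : nat) (A : 'M[R]_n) :
  exists2 K : R, 0 < K & forall v : 'cV[R]_n, `|A *m v| <= K * `|v|.
Proof.
pose S := \sum_i \sum_j `|A i j|.
have S0 : 0 <= S by apply: sumr_ge0 => i _; apply: sumr_ge0.
exists (1 + S); first by rewrite ltr_pwDl.
move=> v; apply: cV_norm_le => [|i]; first by rewrite mulr_ge0// addr_ge0.
rewrite mxE; apply: (le_trans (ler_norm_sum _ _ _)).
apply: (@le_trans _ _ (\sum_j `|A i j| * `|v|)).
  by apply: ler_sum => j _; rewrite normrM ler_wpM2l// entry_norm_le.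
rewrite -mulr_suml ler_wpM2r// ler_wpDl// /S [leRHS](bigD1 i)//= lerDl.
by apply: sumr_ge0 => k _; apply: sumr_ge0.
Qed.

Lemma tangent_cV (R : realType) (n : nat) (f : R -> 'cV[R]_n) (x : R)
    (v : 'cV[R]_n) :
  (forall i, tangent (fun s => f s i 0) x (v i 0)) -> tangent f x v.
Proof.
move=> fv e e0.
have : \forall h \near (0 : R), forall i,
    `|f (x + h) i 0 - f x i 0 - h *: v i 0| <= e * `|h|.
  apply: (@filter_forall _ 'I_n (fun i (h : R) =>
    `|f (x + h) i 0 - f x i 0 - h *: v i 0| <= e * `|h|) (nbhs (0 : R))) => i.
  have [d d0 dP] := fv i e e0.
  by apply/nbhs_ballP; exists d => //= h; rewrite /ball/= sub0r normrN => /dP.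
move=> /nbhs_ballP[d /= d0 dP]; exists d => // h hd.
apply: cV_norm_le => [|i]; first by rewrite mulr_ge0// ltW.
have := dP h; rewrite /ball/= sub0r normrN => /(_ hd i).
by rewrite !mxE.
Qed.

Lemma tangent_mulmx (R : realType) (n : nat) (A : 'M[R]_n) (f : R -> 'cV[R]_n)
    (x : R) (v : 'cV[R]_n) :
  tangent f x v -> tangent (fun s => A *m f s) x (A *m v).
Proof.
move=> fv e e0; have [K K0 KP] := mulmx_bound A.
have [d d0 dP] := fv (e / K) (divr_gt0 e0 K0); exists d => // h /dP hd.
rewrite scalemxAr -!mulmxBr; apply: (le_trans (KP _)).
by rewrite mulrC -ler_pdivlMr// mulrAC.
Qed.

Lemma ac_dom (R : realType) (V V' : normedModType R) (a b K : R) (f : R -> V)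
    (g : R -> V') :
  (forall l r, a <= l -> l <= r -> r <= b ->
    `|f r - f l| <= K * `|g r - g l|) ->
  absolutely_continuous a b g -> absolutely_continuous a b f.
Proof.
move=> fg acg e e0; pose K' := Num.max K 1.
have K0 : 0 < K' by rewrite lt_max ltr01 orbT.
have [d d0 dP] := acg (e / K') (divr_gt0 e0 K0); exists d => // m l r lr dis sd.
apply: (@le_lt_trans _ _ (\sum_i K' * `|g (r i) - g (l i)|)).
  apply: ler_sum => i _; have [al [ll rb]] := lr i.
  by apply: (le_trans (fg _ _ al ll rb)); rewrite ler_wpM2r// le_max lexx.
by rewrite -mulr_sumr mulrC -ltr_pdivlMr//; exact: dP.
Qed.

Lemma ac_lip (R : realType) (V : normedModType R) (a b K : R) (f : R -> V) :
  (forall l r, a <= l -> l <= r -> r <= b -> `|f r - f l| <= K * (r - l)) ->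
  absolutely_continuous a b f.
Proof.
move=> fK; apply: (@ac_dom _ _ R^o a b K f id) => [l r al lr rb|].
  by rewrite [X in K * X]ger0_norm ?subr_ge0//; exact: fK.
move=> e e0; exists e => // m l r lr _ sd.
rewrite (eq_bigr (fun i => r i - l i))// => i _.
by rewrite ger0_norm// subr_ge0; have [_ []] := lr i.
Qed.

Lemma acD (R : realType) (V : normedModType R) (a b : R) (f g : R -> V) :
  absolutely_continuous a b f -> absolutely_continuous a b g ->
  absolutely_continuous a b (fun s => f s + g s).
Proof.
move=> acf acg e e0; have e2 : 0 < e / 2 by rewrite divr_gt0.
have [d1 d10 P1] := acf _ e2; have [d2 d20 P2] := acg _ e2.
exists (Num.min d1 d2); first by rewrite lt_min d10.
move=> m l r lr dis; rewrite lt_min => /andP[s1 s2].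
rewrite [ltRHS]splitr.
apply: (le_lt_trans _ (ltrD (P1 m l r lr dis s1) (P2 m l r lr dis s2))).
rewrite -big_split/=; apply: ler_sum => i _.
by rewrite opprD addrACA ler_normD.
Qed.

Lemma acN (R : realType) (V : normedModType R) (a b : R) (f : R -> V) :
  absolutely_continuous a b f -> absolutely_continuous a b (fun s => - f s).
Proof.
by apply: (@ac_dom _ _ _ a b 1) => l r _ _ _; rewrite mul1r -opprD normrN.
Qed.

Lemma ac_sub (R : realType) (V : normedModType R) (a b a' b' : R) (f : R -> V) :
  a <= a' -> b' <= b ->
  absolutely_continuous a b f -> absolutely_continuous a' b' f.
Proof.
move=> aa bb acf e /acf[d d0 dP]; exists d => // m l r lr; apply: dP => i.
have [al [ll rb]] := lr i.
by split; [exact: le_trans al|split=> //; exact: le_trans rb bb].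
Qed.

Lemma ac_continuous (R : realType) (V : normedModType R) (a b : R)
    (f : R -> V) (e : R) :
  absolutely_continuous a b f -> 0 < e -> exists2 d : R, 0 < d &
  forall l r, a <= l -> l <= r -> r <= b -> r - l < d -> `|f r - f l| < e.
Proof.
move=> acf /acf[d d0 dP]; exists d => // l r al lr rb rld.
have := dP 1%N (fun=> l) (fun=> r); rewrite !big_ord1; apply => //.
by move=> i j; rewrite !ord1 eqxx.
Qed.

Definition vprim (R : realType) (n : nat) (w : measurableTypeR R -> 'cV[R]_n)
  (s : R) : 'cV[R]_n := \col_i prim (fun x => w x i 0) s.

Lemma energy_disjoint (R : realType) (w : measurableTypeR R -> R) (m : nat)
    (l r : 'I_m -> R) :
  sqr_integrable w -> (forall i j, i != j -> r i <= l j \/ r j <= l i) ->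
  \sum_i \int[lebesgue_measure]_(x in `]l i, r i]) (w x ^+ 2) <=
  \int[lebesgue_measure]_x (w x ^+ 2).
Proof.
move=> lw dis.
have lw2 A (mA : measurable A) := @sqr_integrable_sqr R w A lw mA.
pose F (i : 'I_m) : set (measurableTypeR R) := `]l i, r i]%classic.
have mF i : measurable (F i) by exact: measurable_itv.
have mbF : measurable (\big[setU/set0]_(i <- index_enum 'I_m) F i).
  exact: bigsetU_measurable.
apply: le_trans (le_energy_setT lw mbF).
rewrite /Rintegral sum_fine; last first.
  by move=> i _; apply: integrable_fin_num => //; exact: lw2.
rewrite (@ge0_integral_bigsetU _ _ _ _ _ F)//.
- exact: index_enum_uniq.
- apply/trivIsetP => i j _ _ ij; apply/seteqP; split=> x //= [].
  by rewrite /F/= !in_itv/=; have := dis i j ij; lra.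
- by apply: measurable_int; apply: lw2.
- by move=> x _; rewrite lee_fin sqr_ge0.
Qed.

Lemma ac_vprim (R : realType) (n : nat) (w : measurableTypeR R -> 'cV[R]_n)
    (b : R) :
  (forall i, sqr_integrable (fun x => w x i 0)) ->
  absolutely_continuous 0 b (vprim w).
Proof.
move=> lw e e0.
pose E i (A : set (measurableTypeR R)) :=
  \int[lebesgue_measure]_(x in A) (w x i 0 ^+ 2).
have E0 i A : 0 <= E i A by apply: Rintegral_ge0 => x _; exact: sqr_ge0.
pose C := \sum_i E i setT; have C0 : 0 <= C by apply: sumr_ge0 => i _; exact: E0.
(* Weight in Young's inequality sqrt(h E) <= al h + E / al: energies of disjoint intervals sum to at
   most C, so the second terms stay below e / 2, and the lengths are then made small against al. *)
pose al := 2 * (C + 1) / e; have al0 : 0 < al.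
  by rewrite divr_gt0// mulr_gt0// ltr_wpDl.
have n1 : 0 < n%:R + 1 :> R by rewrite ltr_wpDl.
exists (e / 2 / ((n%:R + 1) * al)); first by rewrite !divr_gt0// mulr_gt0.
move=> m l r lr dis sd.
have step k : `|vprim w (r k) - vprim w (l k)| <=
    n%:R * al * (r k - l k) + al^-1 * \sum_i E i `]l k, r k]%classic.
  have [l0 [lk _]] := lr k.
  have comp i : `|(vprim w (r k) - vprim w (l k)) i 0| <=
      al * (r k - l k) + al^-1 * E i `]l k, r k]%classic.
    rewrite !mxE -ler_sqr ?nnegrE//; last first.
      by rewrite addr_ge0// mulr_ge0// ?invr_ge0 ?subr_ge0// ltW.
    rewrite real_normK ?num_real//; apply: (le_trans (prim_energy (lw i) l0 lk)).
    rewrite -/(E i `]l k, r k]%classic).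
    move: (E i _) (E0 i `]l k, r k]%classic) => x x0.
    have y0 : 0 <= r k - l k by rewrite subr_ge0.
    rewrite -subr_ge0 (_ : _ - _ = (al * (r k - l k)) ^+ 2 +
      (r k - l k) * x + (al^-1 * x) ^+ 2); last by field; rewrite gt_eqF.
    by rewrite !addr_ge0 ?sqr_ge0// mulr_ge0.
  apply: cV_norm_le => [|i].
    apply: addr_ge0; apply: mulr_ge0; rewrite ?subr_ge0 ?invr_ge0 ?sumr_ge0//.
    - by rewrite mulr_ge0// ltW.
    - exact: ltW.
  apply: (le_trans (comp i)); rewrite lerD//.
    have n_ge1 : 1 <= n%:R :> R by rewrite ler1n (leq_ltn_trans _ (ltn_ord i)).
    have : 0 <= al * (r k - l k) by rewrite mulr_ge0 ?subr_ge0// ltW.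
    by rewrite -mulrA => h; exact: ler_peMl.
  rewrite ler_wpM2l//; first by rewrite invr_ge0 ltW.
  by rewrite (bigD1 i)//= lerDl sumr_ge0.
apply: (le_lt_trans (ler_sum _ (fun k _ => step k))).
rewrite big_split/= -!mulr_sumr exchange_big/=.
have sE : \sum_i \sum_k E i `]l k, r k]%classic <= C.
  by apply: ler_sum => i _; exact: energy_disjoint.
have h1 : n%:R * al * \sum_k (r k - l k) <= e / 2.
  have sd0 : 0 <= \sum_k (r k - l k).
    by apply: sumr_ge0 => k _; rewrite subr_ge0; have [_ []] := lr k.
  apply: (@le_trans _ _ ((n%:R + 1) * al * \sum_k (r k - l k))).
    by rewrite ler_wpM2r// ler_wpM2r// ?lerDl// ltW.
  by move/ltW : sd; rewrite ler_pdivlMr; [rewrite mulrC|exact: mulr_gt0].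
have h2 : al^-1 * \sum_i \sum_k E i `]l k, r k]%classic < e / 2.
  rewrite mulrC ltr_pdivrMr//; apply: (le_lt_trans sE).
  by rewrite (_ : e / 2 * al = C + 1) ?ltrDl// /al; field; rewrite gt_eqF.
by lra.
Qed.

(** * A priori estimates for controlled paths *)

(* The control lives on the whole line: it is extended by 0 beyond [t]. *)
Definition controlled (R : realType) (n : nat) (b : 'cV[R]_n -> 'cV[R]_n)
    (sigma : 'M[R]_n) (T Y C t : R) (phi : R -> 'cV[R]_n)
    (w : measurableTypeR R -> 'cV[R]_n) : Prop :=
  [/\ 0 <= t <= T, absolutely_continuous 0 t phi, `|phi 0| <= Y,
      forall i, sqr_integrable (fun x => w x i 0) /\
        \int[lebesgue_measure]_x (w x i 0 ^+ 2) <= C &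
      {ae (@lebesgue_measure R), forall s : R, 0 < s < t ->
         tangent phi s (b (phi s) + sigma *m w s)}].

(** Along a controlled path the derivative of this difference is b(phi), free of the control, so it
    is Lipschitz where the path is only Hoelder. *)
Definition drift (R : realType) (n : nat) (sigma : 'M[R]_n)
    (phi : R -> 'cV[R]_n) (w : measurableTypeR R -> 'cV[R]_n) (s : R) :
    'cV[R]_n := phi s - sigma *m vprim w s.

Lemma vprim_tangent (R : realType) (n : nat)
    (w : measurableTypeR R -> 'cV[R]_n) :
  (forall i, sqr_integrable (fun x => w x i 0)) ->
  {ae (@lebesgue_measure R), forall s : R, 0 < s -> tangent (vprim w) s (w s)}.
Proof.
move=> lw.
have aeF := ae_filter_ringOfSetsType (@lebesgue_measure R).
have : {ae (@lebesgue_measure R), forall s : R, forall i, 0 < s ->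
    tangent (prim (fun x => w x i 0)) s (w s i 0)}.
  apply: (@filter_forall _ 'I_n (fun i (s : R) => 0 < s ->
    tangent (prim (fun x => w x i 0)) s (w s i 0))
    (almost_everywhere (@lebesgue_measure R))) => i.
  exact: prim_tangent.
apply: filterS => s H s0; apply: tangent_cV => i.
rewrite (_ : (fun s => _) = prim (fun x => w x i 0)); first exact: H.
by apply/funext => x; rewrite mxE.
Qed.

Lemma vprim0 (R : realType) (n : nat) (w : measurableTypeR R -> 'cV[R]_n) :
  vprim w 0 = 0.
Proof. by apply/colP => i; rewrite !mxE prim0. Qed.

Lemma vprim_holder (R : realType) (n : nat) (w : measurableTypeR R -> 'cV[R]_n)
    (C l r : R) :
  (forall i, sqr_integrable (fun x => w x i 0) /\
     \int[lebesgue_measure]_x (w x i 0 ^+ 2) <= C) ->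
  0 <= l -> l <= r -> `|vprim w r - vprim w l| <= Num.sqrt (C * (r - l)).
Proof.
move=> lw l0 lr; apply: cV_norm_le => [|i]; first exact: sqrtr_ge0.
have [lwi Ci] := lw i; have H := prim_holder lwi l0 lr Ci.
rewrite !mxE -(ger0_norm (sqrtr_ge0 _)) -ler_sqr ?nnegrE//.
rewrite !real_normK ?num_real// sqr_sqrtr//.
by apply: le_trans H; exact: sqr_ge0.
Qed.

Lemma drift_tangent (R : realType) (n : nat) (b : 'cV[R]_n -> 'cV[R]_n)
    (sigma : 'M[R]_n) (T Y C t : R) (phi : R -> 'cV[R]_n)
    (w : measurableTypeR R -> 'cV[R]_n) :
  controlled b sigma T Y C t phi w ->
  {ae (@lebesgue_measure R), forall s : R, 0 < s < t ->
     tangent (drift sigma phi w) s (b (phi s))}.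
Proof.
move=> [_ _ _ lw dphi].
have aeF := ae_filter_ringOfSetsType (@lebesgue_measure R).
have := vprim_tangent (fun i => (lw i).1).
move: dphi; apply: filterS2 => s H1 H2 /[dup] /H1 {}H1 /andP[/H2 {}H2 _].
rewrite -(addrK (sigma *m w s) (b (phi s))).
by apply: tangentD => //; apply: tangentN; exact: tangent_mulmx.
Qed.

Lemma drift_ac (R : realType) (n : nat) (b : 'cV[R]_n -> 'cV[R]_n)
    (sigma : 'M[R]_n) (T Y C t : R) (phi : R -> 'cV[R]_n)
    (w : measurableTypeR R -> 'cV[R]_n) :
  controlled b sigma T Y C t phi w -> absolutely_continuous 0 t (drift sigma phi w).
Proof.
move=> [_ acphi _ lw _]; apply: acD => //; apply: acN.
have [K K0 KP] := mulmx_bound sigma.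
apply: (@ac_dom _ _ _ 0 t K _ (vprim w)); last first.
  by apply: ac_vprim => i; have [] := lw i.
by move=> l r _ _ _; rewrite -mulmxBr.
Qed.

(** Mean value inequality against the slope v with a free majorant H: an exponential H yields
    Gronwall, a linear one the Lipschitz bound for v = 0 and the Euler error for v = b(phi l). *)
Lemma drift_growth (R : realType) (n : nat) (b : 'cV[R]_n -> 'cV[R]_n)
    (sigma : 'M[R]_n) (T Y C t : R) (phi : R -> 'cV[R]_n)
    (w : measurableTypeR R -> 'cV[R]_n) (v : 'cV[R]_n) (l r : R)
    (H h : R -> R) :
  controlled b sigma T Y C t phi w ->
  0 <= l -> l <= r -> r <= t ->
  (forall x y, l <= x -> x <= y -> y <= r -> H x <= H y) ->
  (forall s, l < s < r -> tangent H s (h s)) ->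
  (forall s, l < s < r -> `|b (phi s) - v| <= h s) ->
  `|drift sigma phi w r - drift sigma phi w l - (r - l) *: v| <= H r - H l.
Proof.
move=> cw l0 lr rt ndH tH bh.
rewrite (_ : _ - _ - _ = (drift sigma phi w r - (r - l) *: v) -
    (drift sigma phi w l - (l - l) *: v)); last first.
  rewrite subrr scale0r subr0.
  by move: (drift _ _ _ r) (drift _ _ _ l) => z1 z2; rewrite addrAC.
have aeF := ae_filter_ringOfSetsType (@lebesgue_measure R).
pose g s := drift sigma phi w s - (s - l) *: v.
apply: (@ac_growth _ _ l r g H lr _ ndH).
  apply: acD; first exact: ac_sub (drift_ac cw).
  apply: acN; apply: (@ac_lip _ _ _ _ `|v|) => x y lx xy yr.
  rewrite -scalerBl (_ : y - l - (x - l) = y - x); last by ring.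
  by rewrite normrZ mulrC ger0_norm ?subr_ge0.
have := drift_tangent cw; apply: filterS => s Hs /andP[ls sr].
exists (b (phi s) - v), (h s); split; [|by apply: tH; rewrite ls|].
  apply: tangentD; first by apply: Hs; lra.
  by apply: tangentN; exact: tangent_linear.
by apply: bh; rewrite ls.
Qed.

(** Finiteness must be known before the Gronwall supremum can be absorbed into itself. The d of
    [ac_continuous] does not depend on the point, so each bridge of the real induction raises the
    bound by 1. *)
Lemma ac_bounded (R : realType) (V : normedModType R) (a b : R) (f : R -> V) :
  a <= b -> absolutely_continuous a b f ->
  exists M : R, forall s, a <= s <= b -> `|f s| <= M.
Proof.
move=> ab acf; have [d d0 dP] := ac_continuous acf ltr01.
pose P x := exists M : R, forall s, a <= s <= x -> `|f s| <= M.
apply: (@real_induction _ P a b ab).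
  by exists `|f a| => s sa; have -> : s = a by apply/eqP; rewrite eq_le; lra.
move=> c /andP[ac cb]; exists (d / 2); first lra.
move=> x y /andP[ax xc] /andP[cy yb] cx yc [M MP]; exists (M + 1) => s /andP[as_ sy].
have [sx|xs] := leP s x; first by have := MP s; rewrite as_ sx => /(_ isT); lra.
have := dP x s ax (ltW xs) (le_trans sy yb) ltac:(lra).
have := MP x; rewrite ax lexx => /(_ isT).
have := ler_normD (f s - f x) (f x); rewrite subrK; lra.
Qed.

Lemma tangent_expR (R : realType) (k s : R) : 0 < k ->
  tangent (fun x => expR (k * x)) s (k * expR (k * s)).
Proof.
move=> k0 e e0; have /is_derive_tangent tg := is_derive_expR (k * s).
have [d d0 dP] := tg (e / k) (divr_gt0 e0 k0).
exists (d / k); first exact: divr_gt0.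
move=> h; rewrite ltr_pdivlMr// => hd; have := dP (k * h).
rewrite normrM (gtr0_norm k0) (mulrC k `|h|) => /(_ hd).
have -> : e / k * (`|h| * k) = e * `|h| by field; rewrite gt_eqF.
by rewrite mulrDr /GRing.scale/= (mulrC k h) mulrA.
Qed.

(* Gronwall by weighting: bound [sup_s |phi s| exp(- 2 L s)] by itself. *)
Lemma controlled_bounded (R : realType) (n : nat) (b : 'cV[R]_n -> 'cV[R]_n)
    (sigma : 'M[R]_n) (T Y C L : R) :
  0 <= C -> 0 < L -> (forall x y, `|b x - b y| <= L * `|x - y|) ->
  exists B : R, forall t phi w, controlled b sigma T Y C t phi w ->
    forall s, 0 <= s <= t -> `|phi s| <= B.
Proof.
move=> C0 L0 bL; have [K K0 KP] := mulmx_bound sigma.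
(* Contributions of the control, the departing point and the drift at the origin. *)
pose B0 := K * Num.sqrt (C * T) + Y + `|b 0| * T.
exists (2 * B0 * expR (2 * L * T)) => t phi w cw.
have [/andP[t0 tT] acphi phi0 lw _] := cw.
have [M MP] := ac_bounded t0 acphi.
have L20 : 0 < 2 * L by rewrite mulr_gt0.
pose S := [set `|phi s| * expR (- (2 * L * s)) | s in [set s | 0 <= s <= t]].
have Sne : S !=set0 by exists (`|phi 0| * expR (- (2 * L * 0))), 0 => //=; rewrite lexx.
have Sub : has_ubound S.
  exists M => _ [s /= st <-]; apply: le_trans (MP s st); case/andP: st => s0 _.
  by rewrite ler_piMr// -[leRHS]expR0 ler_expR oppr_le0 mulr_ge0// ltW.
pose m := sup S.
have phi_le s : 0 <= s <= t -> `|phi s| <= m * expR (2 * L * s).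
  move=> st; rewrite -ler_pdivrMr ?expR_gt0// -expRN.
  by apply: ub_le_sup => //; exists s.
have W_le s : 0 <= s <= t -> `|vprim w s| <= Num.sqrt (C * T).
  move=> /andP[s0 st]; have := vprim_holder lw (lexx 0) s0.
  rewrite vprim0 !subr0 => /le_trans; apply; rewrite ler_wsqrtr//.
  by rewrite ler_wpM2l//; exact: le_trans tT.
have A0 : 0 <= `|b 0| := normr_ge0 _.
have m0 : 0 <= m.
  apply: (@le_trans _ _ `|phi 0|) => //.
  by apply: (le_trans (phi_le 0 _)); rewrite ?mulr0 ?expR0 ?mulr1 ?lexx.
(* The exponential term of H below has derivative m L exp(2 L x), which dominates L |phi x|; the
   rate 2 L is what leaves the factor 1/2 in front of m. *)
have phi_le2 s : 0 <= s <= t -> `|phi s| <= B0 + m / 2 * expR (2 * L * s).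
  move=> /[dup] st /andP[s0 s_t].
  pose H x := `|b 0| * x + m / 2 * expR (2 * L * x).
  have := @drift_growth _ _ _ _ _ _ _ _ _ _ 0 0 s H
    (fun x => `|b 0| + m / 2 * (2 * L * expR (2 * L * x))) cw (lexx 0) s0 s_t.
  have H1 x y : 0 <= x -> x <= y -> y <= s -> H x <= H y.
    move=> x0 xy _; rewrite lerD ?ler_wpM2l ?divr_ge0//.
    by rewrite ler_expR ler_wpM2l// ltW.
  have H2 x : 0 < x < s -> tangent H x (`|b 0| + m / 2 * (2 * L * expR (2 * L * x))).
    move=> _; apply: tangentD; last by apply: tangent_mulr; exact: tangent_expR.
    by rewrite -[X in tangent _ _ X]mulr1; apply: tangent_mulr; apply/is_derive_tangent.
  have H3 x : 0 < x < s ->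
      `|b (phi x) - 0| <= `|b 0| + m / 2 * (2 * L * expR (2 * L * x)).
    move=> /andP[x0 xs]; rewrite subr0 -(subrK (b 0) (b (phi x))) addrC.
    apply: (le_trans (ler_normD _ _)); rewrite lerD2l.
    apply: (le_trans (bL _ _)); rewrite subr0.
    have /phi_le : 0 <= x <= t by lra.
    move: (expR _) => E h; have : L * `|phi x| <= L * (m * E) by rewrite ler_wpM2l// ltW.
    by lra.
  move=> /(_ H1 H2 H3); rewrite scaler0 subr0 /drift vprim0 mulmx0 subr0.
  rewrite /H !mulr0 expR0 mulr1 => gr.
  have -> : phi s = (phi s - sigma *m vprim w s - phi 0) +
      (sigma *m vprim w s + phi 0).
    by rewrite -[X in X + _]addrA -opprD subrK.
  apply: (le_trans (ler_normD _ _)).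
  have := ler_normD (sigma *m vprim w s) (phi 0).
  have : `|sigma *m vprim w s| <= K * Num.sqrt (C * T).
    by apply: (le_trans (KP _)); rewrite ler_wpM2l ?W_le// ltW.
  have : `|b 0| * s <= `|b 0| * T by rewrite ler_wpM2l//; lra.
  by rewrite /B0; lra.
(* Absorbing m / 2 gives m <= 2 B0, where B0 is independent of the path. *)
have m_le : m <= B0 + m / 2.
  apply: ge_sup => // _ [s /= st <-]; have := phi_le2 s st.
  have /andP[s0 _] := st.
  have E1 : 1 <= expR (2 * L * s).
    by rewrite -[leLHS]expR0 ler_expR mulr_ge0// ltW.
  rewrite expRN ler_pdivrMr ?expR_gt0//; move: (expR _) E1 => E E1 h.
  have B00 : 0 <= B0.
    have Y0 : 0 <= Y := le_trans (normr_ge0 _) phi0.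
    by rewrite !addr_ge0// mulr_ge0 ?sqrtr_ge0// ?(ltW K0)//; lra.
  have : B0 <= B0 * E by rewrite ler_peMr.
  by lra.
move=> s st; apply: (le_trans (phi_le s st)); apply: ler_pM => //; last first.
- rewrite ler_expR ler_wpM2l ?(ltW L20)//; case/andP: st => _ st; lra.
- lra.
Qed.

(** The constants are uniform over controlled paths. The last estimate is a one-step Euler error of
    order (r - l)^(3/2), hence o(r - l). *)
Lemma controlled_estimates (R : realType) (n : nat) (b : 'cV[R]_n -> 'cV[R]_n)
    (sigma : 'M[R]_n) (T Y C L : R) :
  0 <= C -> 0 < L -> (forall x y, `|b x - b y| <= L * `|x - y|) ->
  exists B K : R, [/\ 0 <= K, 0 <= B & forall t phi w,
    controlled b sigma T Y C t phi w -> [/\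
    forall s, 0 <= s <= t -> `|phi s| <= B,
    forall l r, 0 <= l -> l <= r -> r <= t ->
      `|drift sigma phi w r - drift sigma phi w l| <= K * (r - l),
    forall l r, 0 <= l -> l <= r -> r <= t ->
      `|phi r - phi l| <= K * (r - l + Num.sqrt (C * (r - l))) &
    forall l r, 0 <= l -> l <= r -> r <= t ->
      `|drift sigma phi w r - drift sigma phi w l - (r - l) *: b (phi l)| <=
      L * (K * (r - l + Num.sqrt (C * (r - l)))) * (r - l)]].
Proof.
move=> C0 L0 bL; have [B0 BP] := @controlled_bounded _ _ b sigma T Y C L C0 L0 bL.
have [K0 K00 KP] := mulmx_bound sigma.
(* The bound [B0] may be negative when no controlled path exists. *)
pose B := Num.max B0 0; have B_ge0 : 0 <= B by rewrite le_max lexx orbT.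
pose K1 := `|b 0| + L * B; have K10 : 0 <= K1.
  by rewrite addr_ge0// mulr_ge0// ltW.
pose K := Num.max K1 K0; have K_ge0 : 0 <= K by rewrite le_max K10.
have K1K : K1 <= K by rewrite le_max lexx.
have K0K : K0 <= K by rewrite le_max lexx orbT.
have id_tangent (x c : R) : tangent (fun y => c * y) x c.
  by rewrite -[X in tangent _ _ X]mulr1; apply: tangent_mulr; apply/is_derive_tangent.
exists B, K; split=> // t phi w cw.
have phiB s : 0 <= s <= t -> `|phi s| <= B.
  by move=> st; rewrite le_max (BP _ _ _ cw).
have [_ _ _ lw _] := cw.
have lip l r : 0 <= l -> l <= r -> r <= t ->
    `|drift sigma phi w r - drift sigma phi w l| <= K * (r - l).
  move=> l0 lr rt.
  have := @drift_growth _ _ _ _ _ _ _ _ _ _ 0 l r (fun x => K * x)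
    (fun=> K) cw l0 lr rt.
  rewrite scaler0 subr0 mulrBr; apply => //.
    by move=> x y _ xy _; rewrite ler_wpM2l.
  move=> s /andP[ls sr]; apply: le_trans K1K.
  rewrite subr0 -(subrK (b 0) (b (phi s))) addrC.
  apply: (le_trans (ler_normD _ _)); rewrite lerD2l.
  apply: (le_trans (bL _ _)); rewrite subr0 ler_pM2l// phiB//; lra.
have osc l r : 0 <= l -> l <= r -> r <= t ->
    `|phi r - phi l| <= K * (r - l + Num.sqrt (C * (r - l))).
  move=> l0 lr rt.
  have -> : phi r - phi l = (drift sigma phi w r - drift sigma phi w l) +
      sigma *m (vprim w r - vprim w l).
    by rewrite mulmxBr /drift opprB addrACA subrK addrAC subrr add0r.
  apply: (le_trans (ler_normD _ _)); rewrite mulrDr lerD//; first exact: lip.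
  apply: (le_trans (KP _)); apply: ler_pM => //; first exact: ltW.
  exact: vprim_holder.
split=> // l r l0 lr rt.
set c := L * _.
have := @drift_growth _ _ _ _ _ _ _ _ _ _ (b (phi l)) l r (fun x => c * x)
    (fun=> c) cw l0 lr rt.
rewrite -mulrBr; apply => //.
  move=> x y _ xy _; rewrite ler_wpM2l// /c !mulr_ge0 ?(ltW L0)//.
  by rewrite addr_ge0 ?subr_ge0 ?sqrtr_ge0.
move=> s /andP[ls sr]; apply: (le_trans (bL _ _)); rewrite ler_pM2l//.
apply: (le_trans (osc l s l0 (ltW ls) (le_trans (ltW sr) rt))).
rewrite ler_wpM2l// lerD//; first lra.
by rewrite ler_wsqrtr// ler_wpM2l//; lra.
Qed.

(** * Weak limits of bounded sequences of controls *)

(** Applied to a measure and to a set function along the same F, this reduces sigma-additivity of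
    the latter to comparing two tails. *)
Lemma additive_tail d (X : measurableType d) (R : realType) (m : set X -> R)
    (F : nat -> set X) (n : nat) :
  (forall A B, measurable A -> measurable B -> A `&` B = set0 ->
     m (A `|` B) = m A + m B) ->
  (forall i, measurable (F i)) -> trivIset setT F ->
  m (\bigcup_i F i) = \sum_(0 <= i < n) m (F i) +
    m (\bigcup_i F i `\` \big[setU/set0]_(i < n) F i).
Proof.
move=> mD mF tF.
have m0 : m set0 = 0.
  have := mD set0 set0 measurable0 measurable0 (setI0 _); rewrite setU0.
  by move/eqP; rewrite -subr_eq0 opprD addrA subrr sub0r oppr_eq0 => /eqP.
have mB k : measurable (\big[setU/set0]_(i < k) F i) by exact: bigsetU_measurable.
have -> : \sum_(0 <= i < n) m (F i) = m (\big[setU/set0]_(i < n) F i).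
  elim: n => [|n IH]; first by rewrite big_geq// big_ord0.
  rewrite big_nat_recr//= IH big_ord_recr/= (mD _ _ (mB n) (mF n))//.
  rewrite -bigcup_mkord setI_bigcupl; apply: bigcup0 => i /= ilt.
  by move/trivIsetP : tF; apply => //; rewrite (ltn_eqF ilt).
have mBC : measurable (\bigcup_i F i `\` \big[setU/set0]_(i < n) F i).
  by apply: measurableD; [exact: bigcup_measurable|exact: mB].
rewrite -(mD _ _ (mB n) mBC) ?setDIK// setDUK//; exact: bigsetU_bigcup.
Qed.

(** The bound by Lebesgue measure on D sends tails to 0, which upgrades finite additivity to
    sigma-additivity; it also makes Lebesgue null sets null for [nu], which gives a density by
    Radon-Nikodym. *)
Lemma charge_density (R : realType) (D : set (measurableTypeR R)) (C : R)
    (nu : set (measurableTypeR R) -> R) :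
  0 <= C -> measurable D -> (lebesgue_measure D < +oo)%E ->
  (forall A B, measurable A -> measurable B -> A `&` B = set0 ->
     nu (A `|` B) = nu A + nu B) ->
  (forall A, measurable A -> nu A ^+ 2 <= C * fine (lebesgue_measure (A `&` D))) ->
  exists v : measurableTypeR R -> R,
    (@lebesgue_measure R).-integrable setT (EFin \o v) /\
    forall A, measurable A -> nu A = \int[lebesgue_measure]_(x in A) v x.
Proof.
move=> C0 mD fD nuD nuC.
pose m (A : set (measurableTypeR R)) : R := fine (lebesgue_measure (A `&` D)).
have finI A : measurable A -> lebesgue_measure (A `&` D) \is a fin_num.
  move=> mA; rewrite ge0_fin_numE//; apply: le_lt_trans fD.
  by apply: le_measure; rewrite ?inE//; exact: measurableI.
have m_add A B : measurable A -> measurable B -> A `&` B = set0 ->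
    m (A `|` B) = m A + m B.
  move=> mA mB AB; rewrite /m setIUl measureU//; [|exact: measurableI..|].
    by rewrite fineD// finI.
  by rewrite setIACA AB set0I.
have nu0 : nu set0 = 0.
  have := nuC set0 measurable0; rewrite set0I measure0 mulr0 => h.
  by apply/eqP; rewrite -sqrf_eq0 eq_le h sqr_ge0.
pose n1 := fun A : set (measurableTypeR R) => (nu A)%:E.
have n10 : n1 set0 = 0%E by rewrite /n1 nu0.
have n1fin A : measurable A -> n1 A \is a fin_num by [].
have n1sigma : semi_sigma_additive n1.
  move=> F mF tF mUF.
  have mcvg : (fun n => \sum_(0 <= i < n) m (F i)) @ \oo --> m (\bigcup_i F i).
    have tFD : trivIset setT (fun i => F i `&` D).
      apply/trivIsetP => i j _ _ ij; move/trivIsetP : tF => /(_ i j I I ij) FF.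
      by rewrite setIACA FF set0I.
    have : (fun n => (\sum_(0 <= i < n) lebesgue_measure (F i `&` D))%E) @ \oo -->
        (m (\bigcup_i F i))%:E.
      rewrite /m fineK; last exact: finI.
      rewrite setI_bigcupl; apply: (@measure_semi_sigma_additive _ _ _
        (@lebesgue_measure R)) => //; first by move=> i; exact: measurableI.
      by rewrite -setI_bigcupl; exact: measurableI.
    move=> /fine_cvgP[_].
    rewrite /m; apply: cvg_trans; apply: near_eq_cvg; near=> n.
    by rewrite /= sum_fine// => i _; exact: finI.
  rewrite /n1; apply: (@cvg_trans _ ((fun n => (\sum_(0 <= i < n) nu (F i))%:E) @ \oo)).
    by apply: near_eq_cvg; near=> n; rewrite sumEFin.
  apply: cvg_EFin; first by near=> n.
  apply/cvgrPdist_le => e e0.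
  have e20 : 0 < e ^+ 2 / (C + 1) by rewrite divr_gt0 ?exprn_gt0// ltr_wpDl.
  move/cvgrPdist_le : mcvg => /(_ _ e20); apply: filterS => n /=.
  rewrite (additive_tail n m_add mF tF) (additive_tail n nuD mF tF).
  rewrite ![_ + _ - _]addrAC !subrr !add0r.
  set X := _ `\` _.
  have mX : measurable X.
    by apply: measurableD => //; exact: bigsetU_measurable.
  rewrite ger0_norm ?fine_ge0// => mX_le.
  rewrite -ler_sqr ?nnegrE ?(ltW e0)// real_normK ?num_real//.
  apply: (le_trans (nuC X mX)); apply: (@le_trans _ _ ((C + 1) * m X)).
    by rewrite ler_wpM2r ?fine_ge0// lerDl.
  by rewrite mulrC -ler_pdivlMr// ltr_wpDl.
pose ch := isCharge.Build _ (measurableTypeR R) R n1 n10 n1fin n1sigma.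
pose nuc : {charge set (measurableTypeR R) -> \bar R} := HB.pack n1 ch.
have nudom : nuc `<< (@lebesgue_measure R).
  apply/null_content_dominatesP => A mA A0.
  have := nuC A mA; rewrite (_ : lebesgue_measure (A `&` D) = 0%E); last first.
    by apply: (@subset_measure0 _ _ _ _ _ A) => //; exact: measurableI.
  rewrite mulr0 => h; rewrite /nuc/= /n1; congr EFin.
  by apply/eqP; rewrite -sqrf_eq0 eq_le h sqr_ge0.
exists (fun x => fine (Radon_Nikodym nuc (@lebesgue_measure R) x)); split.
  apply: eq_integrable (Radon_Nikodym_integrable nudom) => //.
  by move=> x _ /=; rewrite fineK// Radon_Nikodym_fin_num.
move=> A mA; rewrite /Rintegral -[LHS]/(fine (nuc A)).
rewrite (Radon_Nikodym_integral nudom mA); congr fine.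
by apply: eq_integral => x _; rewrite fineK// Radon_Nikodym_fin_num.
Unshelve. all: by end_near. Qed.

(** Compactness gives a cluster point; an ultrafilter contains the preimage of a neighbourhood or of
    its complement, so clustering is already convergence. *)
Lemma ultra_bounded_cvg (R : realType) (I : Type) (U : set_system I)
    (u : I -> R) (M : R) :
  UltraFilter U -> (forall k, `|u k| <= M) -> exists l : R, u @ U --> l.
Proof.
move=> UU uM.
have [|l [_ cl]] := @segment_compact R (- M) M (u @ U) _.
  by apply: nearW => k /=; rewrite in_itv/= -ler_norml.
exists l => V Vl; have [//|nV] := in_ultra_setVsetC (u @^-1` V) UU.
by have [x []] := cl _ _ (nV : (u @ U) (~` V)) Vl.
Qed.

Lemma cvg_sum_seq (R : realType) (T : Type) (F : set_system T) (J : Type)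
    (r : seq J) (f : J -> T -> R) (l : J -> R) :
  Filter F -> (forall j, f j @ F --> l j) ->
  \sum_(j <- r) f j x @[x --> F] --> \sum_(j <- r) l j.
Proof.
move=> FF fl; elim: r => [|j r IH].
  by under eq_fun do rewrite big_nil; rewrite big_nil; exact: cvg_cst.
by under eq_fun do rewrite big_cons; rewrite big_cons; exact: cvgD (fl j) IH.
Qed.

Lemma filter_ler_cvg (R : realType) (T : Type) (F : set_system T)
    (f g : T -> R) (l l' : R) :
  ProperFilter F -> f @ F --> l -> g @ F --> l' ->
  (\forall x \near F, f x <= g x) -> l <= l'.
Proof.
move=> FF fl gl fg; rewrite -subr_ge0; apply: (cvgr_to_ge (cvgB gl fl)).
by apply: filterS fg => x; rewrite -subr_ge0.
Qed.

Lemma lty_setI (R : realType) (A B : set (measurableTypeR R)) :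
  measurable A -> measurable B -> (lebesgue_measure B < +oo)%E ->
  (lebesgue_measure (A `&` B) < +oo)%E.
Proof.
move=> mA mB; apply: le_lt_trans; apply: le_measure; rewrite ?inE//.
exact: measurableI.
Qed.

Lemma weak_limit_measure (R : realType) (I : Type) (U : set_system I)
    (D : set (measurableTypeR R)) (C : R) (w : I -> measurableTypeR R -> R) :
  UltraFilter U -> measurable D -> (lebesgue_measure D < +oo)%E ->
  (forall k, sqr_integrable (w k)) ->
  (forall k, \int[lebesgue_measure]_x (w k x ^+ 2) <= C) ->
  exists v : measurableTypeR R -> R,
  (@lebesgue_measure R).-integrable setT (EFin \o v) /\ forall A, measurable A ->
  \int[lebesgue_measure]_(x in A `&` D) w k x @[k --> U] --> \int[lebesgue_measure]_(x in A) v x.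
Proof.
move=> UU mD fD w_int w_le.
have C0k (k : I) : 0 <= C.
  by apply: (@le_trans _ _ _ _ _ _ (w_le k)); apply: Rintegral_ge0 => x _; exact: sqr_ge0.
have [k0 _] := filter_ex (@filterT _ U _).
have C0 : 0 <= C := C0k k0.
have bnd A k : measurable A ->
    (\int[lebesgue_measure]_(x in A `&` D) w k x) ^+ 2 <= C * fine (lebesgue_measure (A `&` D)).
  move=> mA; have mAD : measurable (A `&` D) by exact: measurableI.
  have H := (sqr_Rintegral_le (w_int k) mAD (lty_setI mA mD fD)).
  apply: (le_trans H).
  rewrite mulrC ler_wpM2r ?fine_ge0//; apply: le_trans (w_le k).
  exact: le_energy_setT.
(* For a non-measurable A the implication is vacuous and 0 is a witness; choice then gives a set
   function on all sets. *)
have ex A : exists l : R, measurable A ->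
    \int[lebesgue_measure]_(x in A `&` D) w k x @[k --> U] --> l.
  have [mA|nmA] := pselect (measurable A); last by exists 0.
  have [k|l ul] := @ultra_bounded_cvg R I U
    (fun k => \int[lebesgue_measure]_(x in A `&` D) w k x)
    (Num.sqrt (C * fine (lebesgue_measure (A `&` D)))) UU.
    rewrite -(ger0_norm (sqrtr_ge0 _)) -ler_sqr ?nnegrE// !real_normK ?num_real//.
    by rewrite sqr_sqrtr ?bnd// mulr_ge0// fine_ge0.
  by exists l.
have [nu nuP] := choice ex.
have [A B mA mB AB|A mA|v [iv vP]] := @charge_density R D C nu C0 mD fD.
- have h : \int[lebesgue_measure]_(x in (A `|` B) `&` D) w k x @[k --> U] --> nu A + nu B.
    apply: (@cvg_trans _ ((fun k => \int[lebesgue_measure]_(x in A `&` D) w k x +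
       \int[lebesgue_measure]_(x in B `&` D) w k x) @ U)); last first.
      exact: cvgD (nuP A mA) (nuP B mB).
    apply: near_eq_cvg; apply: nearW => k; rewrite setIUl Rintegral_setU//.
    + exact: measurableI.
    + exact: measurableI.
    + apply: sqr_integrable_int => //.
        by apply: measurableU; exact: measurableI.
      by rewrite -setIUl; apply: lty_setI => //; exact: measurableU.
    + by apply/disj_setPS; rewrite setIACA AB set0I.
  by apply: (cvg_unique _ (nuP _ (measurableU _ _ mA mB)) h).
- rewrite expr2; apply: (cvgr_to_le (cvgM (nuP A mA) (nuP A mA))).
  by apply: nearW => k; apply: le_trans (bnd A k mA); rewrite expr2.
- exists v; split => // A mA; rewrite -vP//; exact: nuP.
Qed.

(* For finitely valued [f], expand [0 <= \int (w k - f) ^+ 2] and pass to the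
   limit in the term that is linear in [w k]. *)
Lemma weak_limit_step (R : realType) (I : Type) (U : set_system I)
    (D : set (measurableTypeR R)) (w : I -> measurableTypeR R -> R)
    (v f : measurableTypeR R -> R) (s : seq R) (E : R) :
  UltraFilter U -> measurable D -> (lebesgue_measure D < +oo)%E ->
  (forall k, sqr_integrable (w k)) ->
  (@lebesgue_measure R).-integrable setT (EFin \o v) ->
  (forall A, measurable A ->
   \int[lebesgue_measure]_(x in A `&` D) w k x @[k --> U] --> \int[lebesgue_measure]_(x in A) v x) ->
  \int[lebesgue_measure]_x (w k x ^+ 2) @[k --> U] --> E ->
  measurable_fun setT f -> (forall x, f x \in s) ->
  \int[lebesgue_measure]_(x in D) (2 * f x * v x - f x ^+ 2) <= E.
Proof.
move=> UU mD fD w_int iv vP cE mf fs.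
(* Duplicates are removed so that each level set of f is counted once in the sums. *)
pose s' := undup s; pose A c : set (measurableTypeR R) := f @^-1` [set c].
have mA c : measurable (A c) by rewrite -[A c]setTI; exact: mf.
have mAD c : measurable (A c `&` D) by exact: measurableI.
have fAD c : (lebesgue_measure (A c `&` D) < +oo)%E by exact: lty_setI.
have tA : trivIset [set` s'] (fun c => A c `&` D).
  apply/trivIsetP => c c' _ _ cc'; apply/seteqP; split=> x //= -[[fx _] [fx' _]].
  by move/eqP : cc'; apply; rewrite -(fx : f x = c) -(fx' : f x = c').
have UA : \big[setU/set0]_(c <- s') (A c `&` D) = D.
  rewrite -bigcup_seq; apply/seteqP; split=> [x [c _ [_ Dx]]//|x Dx].
  by exists (f x) => //=; rewrite mem_undup.
have ivA c : (@lebesgue_measure R).-integrable (A c `&` D) (EFin \o v) by exact: integrableS iv.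
have icst c (k : R) : (@lebesgue_measure R).-integrable (A c `&` D) (EFin \o cst k).
  exact: integrable_cst_lty.
have piece c : \int[lebesgue_measure]_(x in A c `&` D) (2 * f x * v x - f x ^+ 2) =
    2 * c * \int[lebesgue_measure]_(x in A c `&` D) v x - c ^+ 2 * fine (lebesgue_measure (A c `&` D)).
  rewrite -RintegralZl// -Rintegral_cst// -RintegralB//.
  - by apply: eq_Rintegral => x; rewrite inE => -[fx _]; rewrite (fx : f x = c).
  - exact: (integrableZl (mAD c) (2 * c) (ivA c)).
  - exact: icst.
have mfv : measurable_fun D (fun x => 2 * f x * v x - f x ^+ 2).
  have mv : measurable_fun setT v by apply/measurable_EFinP; exact: measurable_int iv.
  apply: (measurable_funS measurableT) => //; apply: measurable_funB.
    by apply: measurable_funM => //; apply: measurable_funM.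
  exact: measurable_funX.
have sumE (g : measurableTypeR R -> R) :
    measurable_fun D g -> (forall c, (@lebesgue_measure R).-integrable (A c `&` D) (EFin \o g)) ->
    \int[lebesgue_measure]_(x in D) g x = \sum_(c <- s') \int[lebesgue_measure]_(x in A c `&` D) g x.
  move=> mg ig; rewrite {1}/Rintegral -[X in integral _ X _]UA.
  rewrite integral_bigsetU_EFin ?undup_uniq//; last first.
    by rewrite UA; exact/measurable_EFinP.
  by rewrite sum_fine// => c _; apply: integrable_fin_num => //; exact: ig.
rewrite sumE//; last first.
  move=> c; have := integrableB (mAD c)
    (integrableZl (mAD c) (2 * c) (ivA c)) (icst c (c ^+ 2)).
  by apply: eq_integrable => // x; rewrite inE => -[fx _] /=; rewrite (fx : f x = c).
rewrite (eq_bigr _ (fun c _ => piece c)).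
have cl : \sum_(c <- s') (2 * c * \int[lebesgue_measure]_(x in A c `&` D) w k x -
    c ^+ 2 * fine (lebesgue_measure (A c `&` D))) @[k --> U] -->
    \sum_(c <- s') (2 * c * \int[lebesgue_measure]_(x in A c `&` D) v x -
    c ^+ 2 * fine (lebesgue_measure (A c `&` D))).
  apply: (@cvg_sum_seq R I U R s'
    (fun c k => 2 * c * \int[lebesgue_measure]_(x in A c `&` D) w k x -
       c ^+ 2 * fine (lebesgue_measure (A c `&` D)))
    (fun c => 2 * c * \int[lebesgue_measure]_(x in A c `&` D) v x -
       c ^+ 2 * fine (lebesgue_measure (A c `&` D))) _) => c.
  have FU : Filter U by case: (@ultra_proper _ U UU).
  apply: cvgB; last exact: (@cvg_cst R _ I U FU).
  apply: cvgM; first exact: (@cvg_cst R _ I U FU).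
  by have := vP (A c `&` D) (mAD c); rewrite -setIA setIid.
suff le_k (k : I) : \sum_(c <- s') (2 * c * \int[lebesgue_measure]_(x in A c `&` D) w k x -
    c ^+ 2 * fine (lebesgue_measure (A c `&` D))) <= \int[lebesgue_measure]_x (w k x ^+ 2).
  by apply: (filter_ler_cvg _ cl cE); apply: nearW => k; exact: le_k.
apply: (@le_trans _ _ (\int[lebesgue_measure]_(x in D) (w k x ^+ 2))); last exact: le_energy_setT.
have lw2 c := sqr_integrable_sqr (w_int k) (mAD c).
rewrite sumE//; last first.
  have [mw _] := w_int k.
  by apply: (measurable_funS measurableT) => //; exact: measurable_funX.
apply: ler_sum => c _.
rewrite -RintegralZl//; last exact: sqr_integrable_int.
rewrite -Rintegral_cst// -RintegralB//; last 2 first.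
- exact: (integrableZl (mAD c) (2 * c) (sqr_integrable_int (w_int k) (mAD c) (fAD c))).
- exact: icst.
apply: le_Rintegral => //.
  exact: (integrableB (mAD c) (integrableZl (mAD c) (2 * c)
    (sqr_integrable_int (w_int k) (mAD c) (fAD c))) (icst c (c ^+ 2))).
move=> x _; rewrite -subr_ge0 (_ : _ - _ = (w k x - c) ^+ 2) ?sqr_ge0//; ring.
Qed.

Import HBSimple HBNNSimple.

(** The integral of v^2 is the supremum over simple h <= v^2. For such h the function f = sign(v)
    sqrt(h) is finitely valued and 2 f v - f^2 >= h, so [weak_limit_step] bounds the integral of h
    by E. The integral is extended-real because integrability of v^2 is part of what is gained. *)
Lemma energy_lsc (R : realType) (I : Type) (U : set_system I)
    (D : set (measurableTypeR R)) (w : I -> measurableTypeR R -> R)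
    (v : measurableTypeR R -> R) (E : R) :
  UltraFilter U -> measurable D -> (lebesgue_measure D < +oo)%E ->
  (forall k, sqr_integrable (w k)) ->
  (@lebesgue_measure R).-integrable setT (EFin \o v) ->
  (forall A, measurable A ->
   \int[lebesgue_measure]_(x in A `&` D) w k x @[k --> U] -->
   \int[lebesgue_measure]_(x in A) v x) ->
  \int[lebesgue_measure]_x (w k x ^+ 2) @[k --> U] --> E ->
  (\int[lebesgue_measure]_(x in D) (v x ^+ 2)%:E <= E%:E)%E.
Proof.
move=> UU mD fD lw iv vP cE.
have mv : measurable_fun setT v by apply/measurable_EFinP; exact: measurable_int iv.
rewrite ge0_integralE; last by move=> x _; rewrite lee_fin sqr_ge0.
apply: ub_ereal_sup => _ [h hv <-].
have hD x : D x -> h x <= v x ^+ 2.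
  by move=> Dx; have := hv x; rewrite patchE mem_set// lee_fin.
have hDC x : ~ D x -> h x = 0.
  move=> Dx; have := hv x; rewrite patchE memNset// lee_fin => h0.
  by apply/eqP; rewrite eq_le h0 fun_ge0.
have -> : sintegral (@lebesgue_measure R) h =
    (\int[lebesgue_measure]_(x in D) (h x)%:E)%E.
  rewrite integral_nnsfun//; congr sintegral; apply/funext => x.
  by rewrite patchE; case: ifPn => // /negP; rewrite inE => /hDC.
pose A : set (measurableTypeR R) := [set x | v x < 0].
have mA : measurable A.
  rewrite (_ : A = v @^-1` `]-oo, 0[); first by rewrite -[X in measurable X]setTI; exact: mv.
  by apply/seteqP; split=> x; rewrite /A/= in_itv.
(* Sign of v, equal to 1 where v vanishes. *)
pose a x : R := 1 - 2 * \1_A x.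
have aE x : (a x = 1 /\ 0 <= v x) \/ (a x = -1 /\ v x <= 0).
  rewrite /a indicE; have [vx|vx] := ltP (v x) 0; [right|left].
    by rewrite mem_set//; split; [rewrite mulr1; ring|exact: ltW].
  rewrite memNset; first by split; [rewrite mulr0 subr0|].
  by rewrite /A/= ltNge vx.
pose f x := a x * Num.sqrt (h x).
pose s := [seq c * Num.sqrt y | c <- [:: 1; -1], y <- finmap.enum_fset (fset_set (range h))].
have fs x : f x \in s.
  apply: allpairs_f.
    by case: (aE x) => -[-> _]; rewrite !inE eqxx ?orbT.
  by rewrite in_fset_set ?inE//; exists x.
have mf : measurable_fun setT f.
  apply: measurable_funM.
    by apply: measurable_funB => //; apply: measurable_funM => //; exact: measurable_indic.
  apply: measurableT_comp => //.
  by apply: continuous_measurable_fun; exact: sqrt_continuous.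
(* With q = sqrt(h) <= |v| the middle expression is 2 q |v| - q^2; the lower bound gives the
   comparison with h, the upper one integrability. *)
have fE x : D x -> h x <= 2 * f x * v x - f x ^+ 2 /\
    2 * f x * v x - f x ^+ 2 <= 2 * (Num.sqrt (h x) * `|v x|).
  move=> Dx; have h0 : 0 <= h x by exact: fun_ge0.
  have sh : Num.sqrt (h x) ^+ 2 = h x by exact: sqr_sqrtr.
  have sv : Num.sqrt (h x) <= `|v x|.
    rewrite -(ger0_norm (sqrtr_ge0 _)) -ler_sqr ?nnegrE//.
    by rewrite !real_normK ?num_real// sh hD.
  have s0 := sqrtr_ge0 (h x); move: sh sv s0; rewrite /f.
  set q := Num.sqrt _ => sh sv s0.
  case: (aE x) => -[-> vx]; move: sv; rewrite ?(ger0_norm vx) ?(ler0_norm vx) => sv.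
    by split; nra.
  by split; nra.
pose M := \sum_(c <- s) `|c|.
have fM x : `|f x| <= M.
  rewrite /M (big_rem (f x))//= lerDl; exact: sumr_ge0.
have ig : (@lebesgue_measure R).-integrable D
    (EFin \o (fun x => 2 * f x * v x - f x ^+ 2)).
  have i1 : (@lebesgue_measure R).-integrable D (EFin \o (fun x => (2 * M) * v x)).
    have ivD : (@lebesgue_measure R).-integrable D (EFin \o v) by exact: integrableS iv.
    exact: (integrableZl mD (2 * M) ivD).
  apply: (le_integrable mD _ _ i1).
    apply/measurable_EFinP; apply: (measurable_funS measurableT) => //.
    apply: measurable_funB; last exact: measurable_funX.
    by apply: measurable_funM => //; apply: measurable_funM.
  move=> x Dx; rewrite lee_fin; have [h1 h2] := fE x Dx.
  have h0 : 0 <= h x by exact: fun_ge0.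
  rewrite ger0_norm; last exact: le_trans h0 h1.
  apply: (le_trans h2); rewrite normrM [`|2 * M|]ger0_norm; last first.
    by rewrite mulr_ge0// sumr_ge0.
  rewrite -mulrA ler_pM2l// ler_wpM2r//.
  have := fM x; rewrite /f normrM (ger0_norm (sqrtr_ge0 _)).
  by case: (aE x) => -[-> _]; rewrite ?normrN normr1 mul1r.
have := weak_limit_step UU mD fD lw iv vP cE mf fs.
rewrite /Rintegral -lee_fin fineK; last exact: integrable_fin_num.
apply: le_trans; apply: ge0_le_integral => //.
- by move=> x _; rewrite lee_fin fun_ge0.
- by apply/measurable_EFinP; exact: (measurable_funS measurableT).
- exact: measurable_int ig.
- by move=> x Dx; rewrite lee_fin; exact: (fE x Dx).1.
Qed.

(** The limit E of the energies is returned besides the bound C: minimality compares the limit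
    control with the limit of the costs. *)
Lemma weak_compactness (R : realType) (I : Type) (U : set_system I) (T C : R)
    (w : I -> measurableTypeR R -> R) :
  UltraFilter U -> (forall k, sqr_integrable (w k)) ->
  (forall k, \int[lebesgue_measure]_x (w k x ^+ 2) <= C) ->
  exists (v : measurableTypeR R -> R) (E : R), [/\ sqr_integrable v,
    \int[lebesgue_measure]_x (w k x ^+ 2) @[k --> U] --> E,
    \int[lebesgue_measure]_x (v x ^+ 2) <= E &
    forall s, 0 <= s <= T -> prim (w k) s @[k --> U] --> prim v s].
Proof.
move=> UU lw wC.
pose D : set (measurableTypeR R) := `[0, T]%classic.
have mD : measurable D by exact: measurable_itv.
have fD : (lebesgue_measure D < +oo)%E by exact: itv_lty.
have [v [iv vP]] := weak_limit_measure UU mD fD lw wC.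
have [k|E cE] := @ultra_bounded_cvg R I U
    (fun k => \int[lebesgue_measure]_x (w k x ^+ 2)) C UU.
  by rewrite ger0_norm//; apply: Rintegral_ge0 => x _; exact: sqr_ge0.
have vE := energy_lsc UU mD fD lw iv vP cE.
have mv : measurable_fun setT v by apply/measurable_EFinP; exact: measurable_int iv.
(* Square-integrability is known on D only, so v is cut off outside; primitives up to T do not
   change. *)
pose v' := v \_ D.
have mv' : measurable_fun setT v' by apply/(measurable_restrictT _ mD); exact: measurable_funS mv.
have v'E : (\int[lebesgue_measure]_x (v' x ^+ 2)%:E =
    \int[lebesgue_measure]_(x in D) (v x ^+ 2)%:E)%E.
  rewrite [RHS]integral_mkcond; apply: eq_integral => x _.
  by rewrite /v' !patchE; case: ifP => //; rewrite expr0n.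
have sv' : sqr_integrable v'.
  split => //; apply/integrableP; split.
    by apply/measurable_EFinP; exact: measurable_funX.
  under eq_integral do rewrite gee0_abs ?lee_fin ?sqr_ge0//.
  by rewrite v'E; apply: le_lt_trans vE _; rewrite ltry.
exists v', E; split => //.
  rewrite -lee_fin /Rintegral fineK; first by rewrite v'E.
  by apply: integrable_fin_num => //; case: sv'.
move=> s /andP[s0 sT].
have sD : `[0, s]%classic `&` D = `[0, s]%classic.
  apply/seteqP; split=> x /=; first by case.
  by rewrite /D/= !in_itv/= => /andP[-> xs]; split => //=; exact: le_trans xs sT.
have := vP `[0, s]%classic (measurable_itv _); rewrite sD.
rewrite (_ : \int[lebesgue_measure]_(x in `[0, s]) v x = prim v' s)//.
apply: eq_Rintegral => x; rewrite inE /v' patchE -sD => -[_ Dx].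
by rewrite mem_set.
Qed.

(** * Limits of controlled paths *)

Lemma cvg_cV (R : realType) (n : nat) (I : Type) (U : set_system I)
    (u : I -> 'cV[R]_n) (l : 'cV[R]_n) :
  Filter U -> (forall i, u k i 0 @[k --> U] --> l i 0) -> u @ U --> l.
Proof.
move=> FU ul; apply/cvgrPdist_le => e e0.
have : \forall k \near U, forall i, `|l i 0 - u k i 0| <= e.
  apply: (@filter_forall _ 'I_n (fun i k => `|l i 0 - u k i 0| <= e) U) => i.
  by have /cvgrPdist_le := ul i; apply.
by apply: filterS => k uk; apply: cV_norm_le; [exact: ltW|move=> i; rewrite !mxE].
Qed.

Lemma cvg_entry (R : realType) (n : nat) (I : Type) (U : set_system I)
    (u : I -> 'cV[R]_n) (l : 'cV[R]_n) (i : 'I_n) :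
  Filter U -> u @ U --> l -> u k i 0 @[k --> U] --> l i 0.
Proof.
move=> FU /cvgrPdist_le ul; apply/cvgrPdist_le => e /ul; apply: filterS => k.
by apply: le_trans; have := entry_norm_le (l - u k) i; rewrite !mxE.
Qed.

Lemma cvg_lip (R : realType) (V W : normedModType R) (I : Type)
    (U : set_system I) (f : V -> W) (K : R) (u : I -> V) (l : V) :
  Filter U -> (forall x y, `|f x - f y| <= K * `|x - y|) ->
  u @ U --> l -> f (u k) @[k --> U] --> f l.
Proof.
move=> FU fK /cvgrPdist_le ul; apply/cvgrPdist_le => e e0.
have K0 : 0 < `|K| + 1 by rewrite ltr_wpDl.
have := ul (e / (`|K| + 1)) (divr_gt0 e0 K0); apply: filterS => k uk.
apply: (le_trans (fK _ _)); apply: (@le_trans _ _ ((`|K| + 1) * `|l - u k|)).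
  by rewrite ler_wpM2r// ler_wpDr// ler_norm.
by rewrite mulrC -ler_pdivlMr.
Qed.

Lemma cvg_mulmx (R : realType) (n : nat) (A : 'M[R]_n) (I : Type)
    (U : set_system I) (u : I -> 'cV[R]_n) (l : 'cV[R]_n) :
  Filter U -> u @ U --> l -> A *m u k @[k --> U] --> A *m l.
Proof.
move=> FU; have [K _ KP] := mulmx_bound A.
by apply: (cvg_lip (f := mulmx A) (K := K)) => x y; rewrite -mulmxBr.
Qed.

Lemma ultra_bounded_cvg_cV (R : realType) (n : nat) (I : Type)
    (U : set_system I) (u : I -> 'cV[R]_n) (M : R) :
  UltraFilter U -> (forall k, `|u k| <= M) ->
  exists l : 'cV[R]_n, u @ U --> l.
Proof.
move=> UU uM; have ex i : exists l : R, u k i 0 @[k --> U] --> l.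
  apply: (ultra_bounded_cvg _ (M := M)) => k.
  exact: le_trans (entry_norm_le _ _) (uM k).
have [l lP] := choice ex; exists (\col_i l i).
by apply: cvg_cV => i; rewrite mxE.
Qed.

Lemma norm_cvg_le (R : realType) (V : normedModType R) (I : Type)
    (U : set_system I) (u : I -> V) (l : V) (c : I -> R) (c' : R) :
  ProperFilter U -> u @ U --> l -> c @ U --> c' ->
  (\forall k \near U, `|u k| <= c k) -> `|l| <= c'.
Proof.
by move=> PU ul cc' uc; apply: (filter_ler_cvg _ (cvg_norm ul) cc' uc).
Qed.

(** A control that vanishes after t has a stationary primitive there, so stopping the path at t also
    stops its drift part. *)
Lemma prim_min (R : realType) (w : measurableTypeR R -> R) (t s : R) :
  sqr_integrable w -> (forall x, t < x -> w x = 0) -> 0 <= t -> 0 <= s ->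
  prim w s = prim w (Num.min s t).
Proof.
move=> lw wt t0 s0; have [//|ts] := leP s t.
apply/eqP; rewrite -subr_eq0 primB//; last exact: ltW.
rewrite (@eq_Rintegral _ _ _ _ _ (cst 0)).
  by rewrite /Rintegral integral0.
by move=> x; rewrite inE/= in_itv/= => /andP[/wt].
Qed.

Lemma modulus_small (R : realType) (K C e : R) :
  0 <= K -> 0 <= C -> 0 < e -> exists2 d : R, 0 < d &
  forall h, 0 <= h -> h <= d -> K * (h + Num.sqrt (C * h)) <= e.
Proof.
(* Both h and sqrt(C h) will be at most a, and 2 K a <= e. *)
move=> K0 C0 e0; pose a := e / (2 * (K + 1)).
have K1 : 0 < K + 1 by rewrite ltr_wpDl.
have C1 : 0 < C + 1 by rewrite ltr_wpDl.
have a0 : 0 < a by rewrite /a divr_gt0 ?mulr_gt0 ?ltr0n.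
exists (Num.min a (a ^+ 2 / (C + 1))).
  by rewrite lt_min a0 divr_gt0// exprn_gt0.
move=> h h0; rewrite le_min [X in _ && X]ler_pdivlMr// => /andP[ha hC].
have sh : Num.sqrt (C * h) <= a.
  rewrite -(ger0_norm (ltW a0)) -sqrtr_sqr ler_wsqrtr//; nra.
have ea : e = 2 * (K + 1) * a by rewrite /a; field; rewrite gt_eqF.
have := sqrtr_ge0 (C * h); nra.
Qed.

(** Convergence is only pointwise in time; the uniform moduli of [controlled_estimates] carry it to
    the moving endpoints and to the derivatives. *)
Lemma limit_path (R : realType) (n : nat) (b : 'cV[R]_n -> 'cV[R]_n)
    (sigma : 'M[R]_n) (T Y C L : R) (F : set 'cV[R]_n) (I : Type)
    (U : set_system I) (t : I -> R) (phi : I -> R -> 'cV[R]_n)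
    (w : I -> measurableTypeR R -> 'cV[R]_n) :
  UltraFilter U -> 0 <= C -> 0 < L ->
  (forall x y, `|b x - b y| <= L * `|x - y|) -> closed F ->
  (forall k, controlled b sigma T Y C (t k) (phi k) (w k)) ->
  (forall k x, t k < x -> w k x = 0) -> (forall k, F (phi k (t k))) ->
  exists (s : R) (p : R -> 'cV[R]_n) (v : measurableTypeR R -> 'cV[R]_n)
    (E : 'I_n -> R),
  [/\ 0 <= s <= T, F (p s), absolutely_continuous 0 s p,
      {ae (@lebesgue_measure R), forall x : R, 0 < x < s ->
         tangent p x (b (p x) + sigma *m v x)} &
      [/\ phi k 0 @[k --> U] --> p 0,
      (forall i, sqr_integrable (fun x => v x i 0)),
      (forall i, \int[lebesgue_measure]_x (w k x i 0 ^+ 2) @[k --> U] --> E i) &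
      (forall i, \int[lebesgue_measure]_x (v x i 0 ^+ 2) <= E i)]].
Proof.
move=> UU C0 L0 bL clF cw wt Ft.
have PU : ProperFilter U := @ultra_proper _ U UU.
have FU : Filter U by case: PU.
have [B [K [K0 B0 est]]] := @controlled_estimates _ _ b sigma T Y C L C0 L0 bL.
have t0 k : 0 <= t k by have [/andP[]] := cw k.
have tT k : t k <= T by have [/andP[]] := cw k.
have T0 : 0 <= T by have [k _] := filter_ex (@filterT _ U _); exact: le_trans (tT k).
have lw k i : sqr_integrable (fun x => w k x i 0).
  by have [_ _ _ /(_ i)[]] := cw k.
have wC k i : \int[lebesgue_measure]_x (w k x i 0 ^+ 2) <= C.
  by have [_ _ _ /(_ i)[]] := cw k.
have [k|s ts] := @ultra_bounded_cvg R I U t T UU; first by rewrite ger0_norm.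
have s0 : 0 <= s by apply: (cvgr_to_ge ts); exact: nearW.
have sT : s <= T by apply: (cvgr_to_le ts); exact: nearW.
have exv i := weak_compactness T UU (fun k => lw k i) (fun k => wC k i).
have [v0 v0P] := choice exv; have [E EP] := choice v0P.
pose v x : 'cV[R]_n := \col_i v0 i x.
have vE i : (fun x => v x i 0) = v0 i by apply/funext => x; rewrite mxE.
have Wcvg x : 0 <= x <= T -> vprim (w k) x @[k --> U] --> vprim v x.
  move=> xT; apply: cvg_cV => i.
  rewrite (_ : (fun k => _) = (fun k => prim (fun y => w k y i 0) x)); last first.
    by apply/funext => k; rewrite mxE.
  by rewrite mxE vE; have [_ _ _ /(_ x xT)] := EP i.
(* Stopped paths are controlled at every x >= 0 and keep the modulus of continuity. *)
pose q k x := phi k (Num.min x (t k)).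
have min_t k x : 0 <= x -> 0 <= Num.min x (t k) <= t k.
  by move=> x0; rewrite le_min x0 t0 ge_min lexx orbT.
have exq x : exists l : 'cV[R]_n, 0 <= x -> q k x @[k --> U] --> l.
  have [x0|x0] := leP 0 x; last by exists 0.
  have [k|l] := @ultra_bounded_cvg_cV R n I U (q^~ x) B UU.
    by have [+ _ _ _] := est _ _ _ (cw k); apply; exact: min_t.
  by exists l.
have [p qp] := choice exq.
pose Z x := p x - sigma *m vprim v x.
have Wmin k x : 0 <= x -> vprim (w k) x = vprim (w k) (Num.min x (t k)).
  move=> x0; apply/colP => i; rewrite !mxE; apply: prim_min => // y /wt ->.
  by rewrite mxE.
have Zcvg x : 0 <= x <= T ->
    drift sigma (phi k) (w k) (Num.min x (t k)) @[k --> U] --> Z x.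
  move=> /[dup] xT /andP[x0 _]; rewrite /drift /Z.
  under eq_fun do rewrite -Wmin//.
  by apply: cvgB; [exact: qp|apply: cvg_mulmx => //; exact: Wcvg].
have mono k l r : l <= r -> Num.min l (t k) <= Num.min r (t k).
  by move=> lr; rewrite le_min !ge_min lr lexx orbT.
have minD k l r : l <= r -> Num.min r (t k) - Num.min l (t k) <= r - l.
  by move=> lr; case: (leP r (t k)); case: (leP l (t k)); lra.
have Zlip l r : 0 <= l -> l <= r -> r <= T -> `|Z r - Z l| <= K * (r - l).
  move=> l0 lr rT.
  have rr : 0 <= r <= T by rewrite (le_trans l0 lr).
  have ll : 0 <= l <= T by rewrite l0 (le_trans lr).
  apply: (norm_cvg_le PU (cvgB (Zcvg r rr) (Zcvg l ll)) (@cvg_cst _ _ _ U FU)).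
  apply: nearW => k; have [_ + _ _] := est _ _ _ (cw k).
  move=> /(_ (Num.min l (t k)) (Num.min r (t k))).
  have /andP[-> _] := min_t k l l0; have /andP[_ ->] := min_t k r (le_trans l0 lr).
  move=> /(_ isT (mono k l r lr) isT) /le_trans; apply.
  by rewrite ler_wpM2l// minD.
have oscq k l r : 0 <= l -> l <= r ->
    `|phi k (Num.min r (t k)) - phi k (Num.min l (t k))| <=
    K * (r - l + Num.sqrt (C * (r - l))).
  move=> l0 lr; have [_ _ + _] := est _ _ _ (cw k).
  move=> /(_ (Num.min l (t k)) (Num.min r (t k))).
  have /andP[-> _] := min_t k l l0; have /andP[_ ->] := min_t k r (le_trans l0 lr).
  move=> /(_ isT (mono k l r lr) isT) /le_trans; apply.
  rewrite ler_wpM2l// lerD ?minD// ler_wsqrtr// ler_wpM2l// minD//.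
have posc l r : 0 <= l -> l <= r -> r <= T ->
    `|p r - p l| <= K * (r - l + Num.sqrt (C * (r - l))).
  move=> l0 lr rT.
  apply: (norm_cvg_le PU (cvgB (qp r (le_trans l0 lr)) (qp l l0)) (@cvg_cst _ _ _ U FU)).
  by apply: nearW => k; exact: oscq.
(* The Euler estimate may fail for a stopped path, so r stays below s: then r < t k eventually along
   U, and the slopes b(q k l) converge with the path. *)
have Zeuler l r : 0 <= l -> l <= r -> r < s ->
    `|Z r - Z l - (r - l) *: b (p l)| <=
    L * (K * (r - l + Num.sqrt (C * (r - l)))) * (r - l).
  move=> l0 lr rs; have rT : r <= T := le_trans (ltW rs) sT.
  have rr : 0 <= r <= T by rewrite (le_trans l0 lr).
  have ll : 0 <= l <= T by rewrite l0 (le_trans lr).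
  have bq : (r - l) *: b (q k l) @[k --> U] --> (r - l) *: b (p l).
    by apply: cvgZr; apply: (cvg_lip FU bL); exact: qp.
  have cv : drift sigma (phi k) (w k) (Num.min r (t k)) -
      drift sigma (phi k) (w k) (Num.min l (t k)) - (r - l) *: b (q k l) @[k --> U]
      --> Z r - Z l - (r - l) *: b (p l).
    by apply: cvgB => //; apply: cvgB; exact: Zcvg.
  apply: (norm_cvg_le PU cv (@cvg_cst _ _ _ U FU)).
  have : \forall k \near U, r < t k by exact: (cvgr_gt s).
  apply: filterS => k rt; have [_ _ _ H] := est _ _ _ (cw k).
  have rk : Num.min r (t k) = r by apply: min_l; exact: ltW.
  have lk : Num.min l (t k) = l by apply: min_l; lra.
  by rewrite /q rk lk; apply: H => //; exact: ltW.
exists s, p, v, E; split.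
- by rewrite s0.
- apply: (@closed_cvg _ _ U PU (fun k => phi k (t k)) F clF); first exact: nearW.
  (* If t k <= s, the stopped path at s already equals phi k (t k); otherwise the gap is bounded by
     the modulus at t k - s, which becomes small. *)
  have : (fun k => q k s + (phi k (t k) - q k s)) @ U --> p s + 0.
    apply: cvgD; first exact: qp.
    apply/cvgr0Pnorm_le => e e0.
    have [d d0 dP] := modulus_small K0 C0 e0.
    have : \forall k \near U, `|s - t k| <= d by move/cvgrPdist_le : ts; apply.
    apply: filterS => k; rewrite ler_norml => /andP[sd _].
    have [tks|stk] := leP (t k) s.
      by rewrite /q min_r// subrr normr0 ltW.
    have := oscq k s (t k) s0 (ltW stk); rewrite minxx => /le_trans; apply.
    by apply: dP; lra.
  by rewrite addr0; under eq_fun do rewrite addrCA subrr addr0.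
- have -> : p = fun x => Z x + sigma *m vprim v x.
    by apply/funext => x; rewrite /Z subrK.
  apply: acD; first by apply: (@ac_lip _ _ _ _ K) => l r l0 lr rs; apply: Zlip => //; lra.
  have [K' _ K'P] := mulmx_bound sigma.
  apply: (@ac_dom _ _ _ 0 s K' _ (vprim v)); first by move=> l r _ _ _; rewrite -mulmxBr.
  by apply: ac_vprim => i; rewrite vE; have [] := EP i.
(* Half of e goes to the Euler error. For h < 0 that estimate starts at x + h, and replacing b(p(x +
   h)) by b(p x) costs the other half. *)
- have Zt x : 0 < x < s -> tangent Z x (b (p x)).
    move=> /andP[x0 xs] e e0; have e4 : 0 < e / 2 / L by rewrite !divr_gt0.
    have [d d0 dP] := modulus_small K0 C0 e4.
    exists (Num.min d (Num.min x (s - x))); first by rewrite !lt_min d0 x0 subr_gt0.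
    have omega h : 0 <= h -> h < d ->
        0 <= L * (K * (h + Num.sqrt (C * h))) <= e / 2.
      move=> h0 hd; have := dP h h0 (ltW hd).
      rewrite -(ler_pM2l L0) [L * (e / 2 / L)]mulrC divfK ?gt_eqF// => ->.
      rewrite andbT.
      by rewrite mulr_ge0 ?(ltW L0)// mulr_ge0// addr_ge0// sqrtr_ge0.
    move=> h; rewrite !lt_min => /and3P[hd hx hs].
    have [h0|h0] := leP 0 h.
      rewrite ger0_norm// in hd hx hs *.
      have := Zeuler x (x + h) (ltW x0) ltac:(lra) ltac:(lra).
      have -> : x + h - x = h by rewrite addrAC subrr add0r.
      move=> /le_trans; apply.
      by have /andP[] := omega h h0 hd; nra.
    rewrite ltr0_norm// in hd hx hs *.
    have h'0 : 0 <= - h by rewrite oppr_ge0 ltW.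
    have := Zeuler (x + h) x ltac:(lra) ltac:(lra) xs.
    have := posc (x + h) x ltac:(lra) ltac:(lra) ltac:(lra).
    have -> : x - (x + h) = - h by ring.
    have := omega _ h'0 hd; set om := K * _ => /andP[om0 ome] pp ZZ.
    have -> : Z (x + h) - Z x - h *: b (p x) =
        - (Z x - Z (x + h) - - h *: b (p (x + h))) + h *: (b (p (x + h)) - b (p x)).
      move: (Z (x + h)) (Z x) => z1 z2.
      by rewrite scalerBr scaleNr opprK opprD opprB addrA subrK.
    apply: (le_trans (ler_normD _ _)); rewrite normrN normrZ ltr0_norm//.
    have bb : `|b (p (x + h)) - b (p x)| <= L * om.
      by apply: (le_trans (bL _ _)); rewrite ler_pM2l// distrC.
    have : - h * `|b (p (x + h)) - b (p x)| <= - h * (L * om) by rewrite ler_wpM2l.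
    by move: (`|b _ - _|) => X; nra.
  have lv i : sqr_integrable (fun x => v x i 0) by rewrite vE; have [] := EP i.
  have aeF := ae_filter_ringOfSetsType (@lebesgue_measure R).
  have := vprim_tangent lv; apply: filterS => x H xs.
  have -> : p = fun x => Z x + sigma *m vprim v x.
    by apply/funext => y; rewrite /Z subrK.
  rewrite /= /Z subrK; apply: tangentD; first exact: Zt.
  by apply: tangent_mulmx; apply: H; case/andP: xs.
- split.
  + have := qp 0 (lexx 0); rewrite /q.
    by under eq_fun do rewrite min_l//.
  + by move=> i; rewrite vE; have [] := EP i.
  + by move=> i; have [] := EP i.
  + by move=> i; rewrite (_ : (fun x => _) = (fun x => v0 i x ^+ 2));
      [have [] := EP i|apply/funext => x; rewrite mxE].
Qed.

(** * Positive definite matrices *)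

Lemma posdef_rV (R : realType) (n : nat) (A : 'M[R]_n) (v : 'rV[R]_n) :
  posdef A -> v != 0 -> 0 < (v *m A *m v^T) 0 0.
Proof.
move=> [_ pA] v0; have := pA v^T; rewrite /quadform trmxK; apply.
by apply: contra_neq v0 => h; rewrite -[v]trmxK h trmx0.
Qed.

Lemma posdef_unitmx (R : realType) (n : nat) (A : 'M[R]_n) :
  posdef A -> A \in unitmx.
Proof.
move=> pA; rewrite unitmxE unitfE; apply/negP => /det0P[v v0 vA].
by have := posdef_rV pA v0; rewrite vA mul0mx mxE ltxx.
Qed.

(* The roots of [char_poly (- A)] are the opposites of the eigenvalues of [A],
   so this polynomial has no root on the nonnegative half-line. *)
Lemma posdef_det_gt0 (R : realType) (n : nat) (A : 'M[R]_n) :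
  posdef A -> 0 < \det A.
Proof.
move=> pA; pose p := char_poly (- A).
have p0 : p.[0] = \det A.
  rewrite horner_coef0 char_poly_det (_ : - A = -1 *: A); last by rewrite scaleN1r.
  rewrite detZ mulrA -exprMn.
  by rewrite mulrNN mulr1 expr1n mul1r.
have noroot x : 0 <= x -> ~~ root p x.
  move=> x0; rewrite -eigenvalue_root_char; apply/negP => /eigenvalueP[v vA v0].
  have := posdef_rV pA v0; rewrite -[A]opprK mulmxN mulNmx vA -scalemxAl.
  have h : 0 <= x * (v *m v^T) 0 0.
    rewrite mulr_ge0// mxE; apply: sumr_ge0 => i _.
    by rewrite mxE -expr2; exact: sqr_ge0.
  by rewrite [X in 0 < X]mxE [X in - X]mxE oppr_gt0 ltNge h.
rewrite -p0 ltNge; apply/negP => p0_le.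
(* A monic polynomial is at least 1 far out, so a nonpositive value at 0 would force a nonnegative
   root by the intermediate value theorem. *)
have [M MP] : exists M, forall x, M <= x -> 1 <= p.[x].
  have lp : lead_coef p = 1 by apply/monicP; exact: char_poly_monic.
  have [M MP] := @polyrcf.poly_pinfty_gt_lc R p ltac:(by rewrite lp).
  by exists M => x /MP; rewrite lp.
have M0 : 0 <= Num.max 0 M by rewrite le_max lexx.
have [|x /andP[x0 _] rx] := @poly_ivt R p 0 (Num.max 0 M) M0.
  by rewrite p0_le (le_trans ler01)// MP// le_max lexx orbT.
by have := noroot x x0; rewrite rx.
Qed.

(** The substitution v = A u reduces positivity of the inverse to that of A. *)
Lemma quadform_invmx (R : realType) (n : nat) (A : 'M[R]_n) (v : 'cV[R]_n) :
  posdef A -> quadform (invmx A) v = quadform A (invmx A *m v).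
Proof.
move=> pA; have uA := posdef_unitmx pA; have [symA _] := pA.
rewrite /quadform trmx_mul trmx_inv symA -!mulmxA; congr ((v^T *m _) 0 0).
by rewrite (mulmxA A) mulmxV// mul1mx.
Qed.

Lemma quadform_posdef_ge0 (R : realType) (n : nat) (A : 'M[R]_n) (v : 'cV[R]_n) :
  posdef A -> 0 <= quadform A v.
Proof.
move=> [_ pA]; have [->|v0] := eqVneq v 0; last exact: ltW (pA v v0).
by rewrite /quadform mulmx0 mxE.
Qed.

Lemma quadform_invmx_ge0 (R : realType) (n : nat) (A : 'M[R]_n) (v : 'cV[R]_n) :
  posdef A -> 0 <= quadform (invmx A) v.
Proof. by move=> pA; rewrite quadform_invmx//; exact: quadform_posdef_ge0. Qed.

(* Cauchy-Schwarz for the form of [A], applied to [invmx A *m v] and a basis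
   vector. *)
Lemma sqr_entry_le_quadform (R : realType) (n : nat) (A : 'M[R]_n)
    (v : 'cV[R]_n) (i : 'I_n) :
  posdef A -> v i 0 ^+ 2 <= A i i * quadform (invmx A) v.
Proof.
move=> pA; have uA := posdef_unitmx pA; have [symA _] := pA.
rewrite quadform_invmx//; set u := invmx A *m v.
have Au : A *m u = v by rewrite /u mulmxA mulmxV// mul1mx.
pose e : 'cV[R]_n := delta_mx i 0.
have eA (x : 'cV[R]_n) : (e^T *m A *m x) 0 0 = (A *m x) i 0.
  by rewrite /e trmx_delta -mulmxA -rowE mxE.
have Aii : A i i = quadform A e by rewrite /quadform eA -colE mxE.
apply: quad_discr; last by rewrite Aii; exact: quadform_posdef_ge0.
have ue : (u^T *m A *m e) 0 0 = v i 0.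
  rewrite (_ : u^T *m A *m e = (e^T *m A *m u)^T); first by rewrite mxE eA Au.
  by rewrite !trmx_mul symA trmxK mulmxA.
have entB (M N : 'M[R]_1) : (M - N) 0 0 = M 0 0 - N 0 0 by rewrite !mxE.
have entZ a (M : 'M[R]_1) : (a *: M) 0 0 = a * M 0 0 by rewrite !mxE.
move=> c; have := quadform_posdef_ge0 (u - c *: e) pA.
rewrite [X in 0 <= X](_ : _ = quadform A u - c * 2 * v i 0 + c ^+ 2 * A i i)//.
have -> : quadform A (u - c *: e) =
    ((u^T - c *: e^T) *m A *m (u - c *: e)) 0 0.
  congr ((_ *m _ *m _) 0 0); by apply/matrixP => ? ?; rewrite !mxE.
rewrite !mulmxBl !mulmxBr -!scalemxAl -!scalemxAr.
rewrite -?scalemxAl !entB !entZ ue eA Au -/(quadform A e) -Aii /quadform; ring.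
Qed.

(** * Departing points and paths *)

Lemma action_ge0 (R : realType) (n : nat) (b : 'cV[R]_n -> 'cV[R]_n)
    (sigma : 'M[R]_n) (t : R) (phi : R -> 'cV[R]_n) :
  (0 <= action b sigma t phi)%E.
Proof.
rewrite /action; case: ifP => // _; apply: le_ereal_inf_tmp => _ [w _ <-].
apply: mule_ge0; first by rewrite lee_fin invr_ge0.
by apply: integral_ge0 => x _; rewrite lee_fin sumr_ge0// => i _; exact: sqr_ge0.
Qed.

Lemma quasi_potential_ge0 (R : realType) (n : nat) (b : 'cV[R]_n -> 'cV[R]_n)
    (sigma : 'M[R]_n) (T : R) (D : set 'cV[R]_n) (y : 'cV[R]_n) :
  (0 <= quasi_potential b sigma T D y)%E.
Proof.
apply: le_ereal_inf_tmp => _ [t _ <-]; apply: le_ereal_inf_tmp => _ [phi _ <-].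
exact: action_ge0.
Qed.

Lemma quasi_potential_le (R : realType) (n : nat) (b : 'cV[R]_n -> 'cV[R]_n)
    (sigma : 'M[R]_n) (T : R) (D : set 'cV[R]_n) (phi : R -> 'cV[R]_n) (t : R) :
  0 <= t <= T -> boundary D (phi t) ->
  (quasi_potential b sigma T D (phi 0%R) <= action b sigma t phi)%E.
Proof.
move=> tT Dphi; apply: (@le_trans _ _ (ereal_inf [set action b sigma t phi0
    | phi0 in [set phi0 : R -> 'cV[R]_n | phi0 0%R = phi 0%R /\ boundary D (phi0 t)]])).
  by apply: ereal_inf_lbound; exists t => //=; rewrite in_itv.
by apply: ereal_inf_lbound; exists phi.
Qed.

Lemma Gam_le_J (R : realType) (n : nat) (b : 'cV[R]_n -> 'cV[R]_n)
    (sigma Sigma : 'M[R]_n) (x0 : 'cV[R]_n) (T eps : R) (D : set 'cV[R]_n)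
    (phi : R -> 'cV[R]_n) (t : R) :
  0 <= t <= T -> boundary D (phi t) ->
  (Gam b sigma T D x0 Sigma eps (phi 0%R) <= J b sigma x0 Sigma eps t phi)%E.
Proof. by move=> tT Dphi; rewrite /Gam /J leeD2r// quasi_potential_le. Qed.

Lemma minimal_J_le_Gam (R : realType) (n : nat) (b : 'cV[R]_n -> 'cV[R]_n)
    (sigma Sigma : 'M[R]_n) (x0 : 'cV[R]_n) (T eps : R) (D : set 'cV[R]_n)
    (y : 'cV[R]_n) :
  (minimal_J b sigma T D x0 Sigma eps <= Gam b sigma T D x0 Sigma eps y)%E.
Proof.
(* The initial cost is real, so it moves to the other side and stays outside both infima defining
   Q. *)
rewrite /Gam -leeBlDr//; apply: le_ereal_inf_tmp => _ [t tT <-].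
apply: le_ereal_inf_tmp => _ [phi [phi0 Dphi] <-]; rewrite leeBlDr// -phi0.
apply: (@le_trans _ _ (ereal_inf [set J b sigma x0 Sigma eps t phi0
    | phi0 in [set phi0 : R -> 'cV[R]_n | boundary D (phi0 t)]])).
  by apply: ereal_inf_lbound; exists t.
by apply: ereal_inf_lbound; exists phi.
Qed.

Lemma argmin_Gam_le (R : realType) (n : nat) (b : 'cV[R]_n -> 'cV[R]_n)
    (sigma Sigma : 'M[R]_n) (x0 : 'cV[R]_n) (T eps : R) (D : set 'cV[R]_n)
    (y : 'cV[R]_n) :
  is_argmin (Gam b sigma T D x0 Sigma eps) y ->
  (Gam b sigma T D x0 Sigma eps y <= minimal_J b sigma T D x0 Sigma eps)%E.
Proof.
move=> ymin; apply: le_ereal_inf_tmp => _ [t tT <-].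
apply: le_ereal_inf_tmp => _ [phi Dphi <-]; apply: (le_trans (ymin (phi 0))).
by apply: Gam_le_J => //; move: tT; rewrite /= in_itv.
Qed.

Lemma most_probable_path_attains (R : realType) (n : nat)
    (b : 'cV[R]_n -> 'cV[R]_n) (sigma Sigma : 'M[R]_n) (x0 : 'cV[R]_n)
    (T eps : R) (D : set 'cV[R]_n) (phi : R -> 'cV[R]_n) (t : R) :
  most_probable_path b sigma T D x0 Sigma eps phi t <->
  attains_minimal_J b sigma T D x0 Sigma eps phi t.
Proof.
split=> [[y ymin [tT phi0 Dphi aQ]]|[tT Dphi Jm]].
  split => //; rewrite /J phi0 aQ -/(Gam b sigma T D x0 Sigma eps y).
  by apply/eqP; rewrite eq_le argmin_Gam_le//= minimal_J_le_Gam.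
have Gm := Gam_le_J b sigma Sigma x0 eps tT Dphi.
exists (phi 0).
  by move=> z; apply: (le_trans Gm); rewrite Jm; exact: minimal_J_le_Gam.
split => //; apply/eqP; rewrite eq_le quasi_potential_le// andbT.
(* [Jm] turns this into J <= Gamma at phi 0; the initial cost is real and cancels, leaving the
   action below Q. *)
have := minimal_J_le_Gam b sigma Sigma x0 T eps D (phi 0).
by rewrite -Jm /J /Gam leeD2rE.
Qed.

(** The posterior weight is c exp(- Gamma / eps) with c > 0, hence strictly decreasing in Gamma,
    with value 0 at +oo. An equality of booleans serves both directions of the argmin and argmax
    equivalence. *)
Lemma low_noise_posterior_le (R : realType) (n : nat)
    (b : 'cV[R]_n -> 'cV[R]_n) (sigma Sigma : 'M[R]_n) (x0 : 'cV[R]_n)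
    (T eps : R) (D : set 'cV[R]_n) (y z : 'cV[R]_n) :
  0 < eps -> posdef Sigma ->
  (low_noise_posterior b sigma T D (gaussian_density x0 Sigma) eps z <=
   low_noise_posterior b sigma T D (gaussian_density x0 Sigma) eps y)%E =
  (Gam b sigma T D x0 Sigma eps y <= Gam b sigma T D x0 Sigma eps z)%E.
Proof.
move=> eps0 pS; rewrite /low_noise_posterior /Gam /gaussian_density.
set c := (Num.sqrt _)^-1.
(* A nonpositive determinant would make the square root, and with it c, equal to 0. *)
have c0 : 0 < c.
  rewrite invr_gt0 sqrtr_gt0 mulr_gt0 ?posdef_det_gt0// exprn_gt0//.
  by rewrite mulr_gt0// pi_gt0.
have key (q s : R) : ((c * expR (- s))%:E * expeR (- ((eps^-1)%:E * q%:E)) =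
    (c * expR (- (eps^-1 * (q + eps * s))))%:E)%E.
  rewrite -[((eps^-1)%:E * q%:E)%E]EFinM -EFinN /= -EFinM -mulrA -expRD; congr (c * expR _)%:E.
  by field; rewrite gt_eqF.
have keyoo (s : R) : ((c * expR (- s))%:E * expeR (- ((eps^-1)%:E * +oo)) = 0 :> \bar R)%E.
  by rewrite gt0_muley ?lte_fin ?invr_gt0//= mule0.
move: (quasi_potential_ge0 b sigma T D y) (quasi_potential_ge0 b sigma T D z).
case: (quasi_potential b sigma T D y) => [q||]//; case: (quasi_potential b sigma T D z) => [r||]// _ _.
- rewrite !key -!EFinD !lee_fin ler_pM2l// ler_expR lerN2 ler_pM2l ?invr_gt0//.
- by rewrite key keyoo leey lee_fin mulr_ge0 ?expR_ge0// ltW.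
- rewrite key keyoo -EFinD addye// lee_fin leNgt mulr_gt0 ?expR_gt0//=.
- by rewrite !keyoo lexx.
Qed.

(** * Existence of a minimiser *)

Lemma cvg_initial_cost (R : realType) (n : nat) (x0 : 'cV[R]_n)
    (Sigma : 'M[R]_n) (I : Type) (U : set_system I) (u : I -> 'cV[R]_n)
    (y : 'cV[R]_n) :
  Filter U -> u @ U --> y ->
  initial_cost x0 Sigma (u k) @[k --> U] --> initial_cost x0 Sigma y.
Proof.
move=> FU uy.
have icE z : initial_cost x0 Sigma z = 2^-1 * \sum_i (z - x0) i 0 *
    (invmx Sigma *m (z - x0)) i 0.
  rewrite /initial_cost /quadform -mulmxA mxE; congr (_ * _).
  by apply: eq_bigr => i _; rewrite [(_^T) _ _]mxE.
have cu : u k - x0 @[k --> U] --> y - x0.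
  by apply: cvgB => //; exact: (@cvg_cst _ _ _ U FU).
rewrite icE; under eq_fun do rewrite icE.
apply: cvgM; first exact: (@cvg_cst _ _ _ U FU).
apply: (@cvg_sum_seq R I U _ _ (fun i k => (u k - x0) i 0 *
  (invmx Sigma *m (u k - x0)) i 0)) => i.
by apply: cvgM; apply: cvg_entry => //; exact: cvg_mulmx.
Qed.

Lemma initial_cost_ge0 (R : realType) (n : nat) (x0 : 'cV[R]_n)
    (Sigma : 'M[R]_n) (y : 'cV[R]_n) :
  posdef Sigma -> 0 <= initial_cost x0 Sigma y.
Proof. by move=> pS; rewrite mulr_ge0 ?invr_ge0// quadform_invmx_ge0. Qed.

(** [sqr_entry_le_quadform] bounds each entry of y - x0, the diagonal of Sigma taking the place of
    its largest eigenvalue. *)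
Lemma initial_cost_coercive (R : realType) (n : nat) (x0 : 'cV[R]_n)
    (Sigma : 'M[R]_n) (M : R) :
  posdef Sigma -> exists Y : R,
    forall y, initial_cost x0 Sigma y <= M -> `|y| <= Y.
Proof.
move=> pS; pose S := \sum_i `|Sigma i i|.
exists (`|x0| + Num.sqrt (S * (2 * M))) => y yM.
rewrite -(subrK x0 y) addrC; apply: (le_trans (ler_normD _ _)).
rewrite lerD2l; apply: cV_norm_le => [|i]; first exact: sqrtr_ge0.
rewrite -sqrtr_sqr ler_wsqrtr//.
apply: (le_trans (sqr_entry_le_quadform (y - x0) i pS)).
have q0 := quadform_invmx_ge0 (y - x0) pS.
apply: ler_pM => //.
(* Nonnegativity of the diagonal: at a basis vector the same inequality reads 1 <= Sigma i i * q
   with q >= 0. *)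
- have := sqr_entry_le_quadform (delta_mx i 0) i pS.
  rewrite mxE !eqxx expr1n => h; rewrite leNgt; apply/negP => h'.
  have := quadform_invmx_ge0 (delta_mx i 0 : 'cV[R]_n) pS; nra.
- by apply: (le_trans (ler_norm _)); rewrite /S (bigD1 i)//= lerDl sumr_ge0.
- by move: yM; rewrite /initial_cost mulrC ler_pdivrMr// mulrC.
Qed.

Lemma sqnorm_integral (R : realType) (n : nat) (D : set (measurableTypeR R))
    (w : measurableTypeR R -> 'cV[R]_n) :
  measurable D -> (forall i, measurable_fun D (fun x => w x i 0)) ->
  (\int[lebesgue_measure]_(x in D) (sqnorm (w x))%:E =
   \sum_i \int[lebesgue_measure]_(x in D) (w x i 0 ^+ 2)%:E)%E.
Proof.
move=> mD mw; rewrite -ge0_integral_sum//.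
- by apply: eq_integral => x _; rewrite /sqnorm sumEFin.
- by move=> i; apply/measurable_EFinP; exact: measurable_funX.
- by move=> i x _; rewrite lee_fin sqr_ge0.
Qed.

(** Finite total cost makes every component square-integrable, as all terms are nonnegative;
    extension by zero leaves the cost unchanged. *)
Lemma extend_control (R : realType) (n : nat) (t : R)
    (w : measurableTypeR R -> 'cV[R]_n) :
  (forall i, measurable_fun (`[0, t]%classic : set (measurableTypeR R))
    (fun x => w x i 0)) ->
  (control_cost t w < +oo)%E ->
  let w' x : 'cV[R]_n := if x \in `[0, t] then w x else 0 in
  (forall i, sqr_integrable (fun x => w' x i 0)) /\
  control_cost t w =
    (2^-1 * \sum_i \int[lebesgue_measure]_x (w' x i 0 ^+ 2))%:E.
Proof.
move=> mw fw w'.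
pose D : set (measurableTypeR R) := `[0, t]%classic.
have mD : measurable D by exact: measurable_itv.
have fin : (\sum_i \int[lebesgue_measure]_(x in D) (w x i 0 ^+ 2)%:E < +oo)%E.
  rewrite -sqnorm_integral//; move: fw; rewrite /control_cost.
  rewrite [X in _ -> (X < _)%E](_ : _ =
    (2%:E * (2^-1%:E * \int[lebesgue_measure]_(x in D) (sqnorm (w x))%:E))%E).
    by move=> fw; rewrite lte_mul_pinfty.
  by rewrite muleA -EFinM divff// mul1e.
have int0 i : (0 <= \int[lebesgue_measure]_(x in D) (w x i 0 ^+ 2)%:E)%E.
  by apply: integral_ge0 => x _; rewrite lee_fin sqr_ge0.
have fini i : (\int[lebesgue_measure]_(x in D) (w x i 0 ^+ 2)%:E < +oo)%E.
  apply: le_lt_trans fin; rewrite (bigD1 i)//= leeDl// sume_ge0//.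
have w'E i : (fun x => w' x i 0) = (fun x => w x i 0) \_ D.
  apply/funext => x; rewrite /w' patchE mem_setE.
  by case: ifP => // _; rewrite mxE.
have intE i : (\int[lebesgue_measure]_x (w' x i 0 ^+ 2)%:E =
    \int[lebesgue_measure]_(x in D) (w x i 0 ^+ 2)%:E)%E.
  rewrite [RHS]integral_mkcond; apply: eq_integral => x _.
  by rewrite /w' patchE mem_setE; case: ifP => // _; rewrite mxE expr0n.
have sq i : sqr_integrable (fun x => w' x i 0).
  have mw' : measurable_fun setT (fun x => w' x i 0).
    by rewrite w'E; apply/(measurable_restrictT _ mD); exact: mw.
  split => //; apply/integrableP; split.
    by apply/measurable_EFinP; exact: measurable_funX.
  under eq_integral do rewrite gee0_abs ?lee_fin ?sqr_ge0//.
  by rewrite intE; exact: fini.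
split => //; rewrite /control_cost sqnorm_integral// EFinM; congr (_ * _)%E.
rewrite -sumEFin; apply: eq_bigr => i _; rewrite -intE /Rintegral fineK//.
by apply: integrable_fin_num => //; case: (sq i).
Qed.

(** Only an inequality, because the control may carry energy outside [[0, t]]. *)
Lemma control_cost_le (R : realType) (n : nat) (t : R)
    (w : measurableTypeR R -> 'cV[R]_n) (E : 'I_n -> R) :
  (forall i, sqr_integrable (fun x => w x i 0)) ->
  (forall i, \int[lebesgue_measure]_x (w x i 0 ^+ 2) <= E i) ->
  (control_cost t w <= (2^-1 * \sum_i E i)%:E)%E.
Proof.
move=> lw wE; rewrite /control_cost EFinM lee_pmul2l//.
pose D : set (measurableTypeR R) := `[0, t]%classic.
have mD : measurable D by exact: measurable_itv.
rewrite (@sqnorm_integral R n D)//; last first.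
  by move=> i; have [mw _] := lw i; exact: measurable_funS mw.
rewrite -sumEFin; apply: lee_sum => i _; have [mw iw] := lw i.
apply: (@le_trans _ _ (\int[lebesgue_measure]_x (w x i 0 ^+ 2)%:E)%E).
  apply: ge0_subset_integral => //; first exact: measurable_int iw.
  by move=> x _; rewrite lee_fin sqr_ge0.
by rewrite -(fineK (integrable_fin_num _ iw))// lee_fin; exact: wE.
Qed.

Lemma boundary_closed (X : topologicalType) (D : set X) : closed (boundary D).
Proof.
rewrite /boundary setDE; apply: closedI; first exact: closed_closure.
by apply: open_closedC; exact: open_interior.
Qed.

Lemma lipschitz_bound (R : realType) (V W : normedModType R) (b : V -> W) :
  lipschitz b -> exists2 L : R, 0 < L &
    forall x y, `|b x - b y| <= L * `|x - y|.
Proof.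
move=> [M [_ MP]]; exists (`|M| + 1); first by rewrite ltr_wpDl.
move=> x y; have ML : M < `|M| + 1 by rewrite ltr_pwDr// ler_norm.
exact: (MP _ ML (x, y)).
Qed.

Lemma minimal_J_attained (R : realType) (n : nat) (eps T : R)
    (b : 'cV[R]_n -> 'cV[R]_n) (sigma Sigma : 'M[R]_n) (x0 : 'cV[R]_n)
    (D : set 'cV[R]_n) :
  0 < eps -> 0 < T -> lipschitz b -> posdef Sigma -> boundary D !=set0 ->
  exists (phi : R -> 'cV[R]_n) (t : R),
    attains_minimal_J b sigma T D x0 Sigma eps phi t.
Proof.
move=> eps0 T0 /lipschitz_bound[L L0 bL] pS [y0 Dy0].
set m := minimal_J b sigma T D x0 Sigma eps.
have m_le phi t : 0 <= t <= T -> boundary D (phi t) ->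
    (m <= J b sigma x0 Sigma eps t phi)%E.
  move=> tT Dphi; apply: (le_trans (minimal_J_le_Gam _ _ _ _ _ _ _ (phi 0))).
  exact: Gam_le_J.
have ic0 y := initial_cost_ge0 x0 y pS.
have m_ge0 : (0 <= m)%E.
  apply: le_ereal_inf_tmp => _ [t _ <-]; apply: le_ereal_inf_tmp => _ [phi _ <-].
  by rewrite adde_ge0 ?action_ge0// lee_fin mulr_ge0// ltW.
have m_fin : m \is a fin_num.
  rewrite ge0_fin_numE//.
  have h0T : (0 : R) <= 0 <= T by apply/andP; split => //; exact: ltW.
  (* At t = 0 the differential equation ranges over an empty interval, so the zero control is
     admissible for the constant path, at no cost. *)
  apply: (le_lt_trans (m_le (fun=> y0) 0 h0T Dy0)).
  rewrite /J /action asboolT; last first.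
    by apply: (@ac_lip _ _ _ _ 0) => l r _ _ _; rewrite subrr normr0 mul0r.
  apply: (@le_lt_trans _ _ (0 + (eps * initial_cost x0 Sigma y0)%:E)%E); last first.
    by rewrite add0e ltry.
  rewrite leeD2r//; apply: ereal_inf_lbound; exists (fun=> 0).
    split=> [i|]; first exact: measurable_cst.
    apply: aeW => s; rewrite in_itv/= => /andP[s0 s0'].
    by have := lt_trans s0 s0'; rewrite ltxx.
  by rewrite /control_cost set_itv1 integral_set1 mule0.
pose m0 := fine m; have m0E : m = m0%:E by rewrite fineK.
(* A control is chosen along with each path because the action is itself an infimum; the three
   nested infima are approached together within 1 / (k + 1). *)
have ex (k : nat) : exists x : R * (R -> 'cV[R]_n) * (R -> 'cV[R]_n),
    [/\ 0 <= x.1.1 <= T, boundary D (x.1.2 x.1.1),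
        absolutely_continuous 0 x.1.1 x.1.2,
        deviation b sigma x.1.1 x.1.2 x.2 &
        (control_cost x.1.1 x.2 + (eps * initial_cost x0 Sigma (x.1.2 0))%:E <
         (m0 + k.+1%:R^-1)%:E)%E].
  have : (m < (m0 + k.+1%:R^-1)%:E)%E by rewrite m0E lte_fin ltrDl invr_gt0.
  move=> /ereal_inf_lt[_ [t tT <-]] /ereal_inf_lt[_ [phi Dphi <-]].
  rewrite /J -lteBrDr// /action; case: asboolP => // acphi.
  move=> /ereal_inf_lt[_ [w dw <-]]; rewrite lteBrDr// => wlt.
  by exists (t, phi, w); split => //=; move: tT; rewrite /= in_itv.
have [x xP] := choice ex.
pose t k := (x k).1.1; pose phi k := (x k).1.2.
pose w k (s : measurableTypeR R) : 'cV[R]_n :=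
  if s \in `[0, t k] then (x k).2 s else 0.
have eps_ic k := mulr_ge0 (ltW eps0) (ic0 (phi k 0)).
have ccfin k : (control_cost (t k) (x k).2 < +oo)%E.
  have [_ _ _ _ h] := xP k; apply: le_lt_trans (lt_trans h (ltry _)).
  by rewrite leeDl// lee_fin; exact: eps_ic.
have wP k : (forall i, sqr_integrable (fun s => w k s i 0)) /\
    control_cost (t k) (x k).2 =
    (2^-1 * \sum_i \int[lebesgue_measure]_s (w k s i 0 ^+ 2))%:E.
  by have [_ _ _ [mw _] _] := xP k; exact: extend_control mw (ccfin k).
pose En k i := \int[lebesgue_measure]_s (w k s i 0 ^+ 2).
have En0 k i : 0 <= En k i by apply: Rintegral_ge0 => s _; exact: sqr_ge0.
have Jlt k : 2^-1 * \sum_i En k i + eps * initial_cost x0 Sigma (phi k 0) <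
    m0 + k.+1%:R^-1.
  by have [_ _ _ _] := xP k; have [_ ->] := wP k; rewrite -EFinD lte_fin.
have k1 (k : nat) : k.+1%:R^-1 <= 1 :> R by rewrite invf_le1// ler1n.
have Jlt1 k : 2^-1 * \sum_i En k i + eps * initial_cost x0 Sigma (phi k 0) <
    m0 + 1.
  by apply: (lt_le_trans (Jlt k)); rewrite lerD2l.
(* The 2 undoes the factor 1/2 of the cost, and the 1 bounds the errors 1 / (k + 1). *)
pose C := 2 * (m0 + 1).
have sumE0 k : 0 <= \sum_i En k i by apply: sumr_ge0.
have EC k i : En k i <= C.
  have : En k i <= \sum_i En k i by rewrite (bigD1 i)//= lerDl sumr_ge0.
  have := Jlt1 k; have := eps_ic k; rewrite /C.
  move: (\sum_i _) (eps * _) (En k i) => z1 z2 z3; lra.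
have C0 : 0 <= C by rewrite mulr_ge0// addr_ge0// fine_ge0.
have [Y YP] := initial_cost_coercive x0 ((m0 + 1) / eps) pS.
have cw k : controlled b sigma T Y C (t k) (phi k) (w k).
  have [tT Dphi acphi [_ dphi] _] := xP k; split => //.
  - apply: YP; have : eps * initial_cost x0 Sigma (phi k 0) <= m0 + 1.
      apply: le_trans (ltW (Jlt1 k)); rewrite lerDr.
      by apply: mulr_ge0 => //; exact: sumE0.
    by rewrite ler_pdivlMr// mulrC.
  - by move=> i; have [lw _] := wP k; split; [exact: lw|exact: EC].
  - have aeF := ae_filter_ringOfSetsType (@lebesgue_measure R).
    move: dphi; apply: filterS => s ds /andP[s0 st].
    apply/is_derive_tangent; rewrite /w in_itv/= (ltW s0) (ltW st)/=.
    by apply: ds; rewrite in_itv/= s0.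
have wt k s : t k < s -> w k s = 0.
  by move=> ts; rewrite /w in_itv/= [s <= _]leNgt ts andbF.
(* Refining the filter at infinity makes 1 / (k + 1) tend to 0 along U. *)
have [U [UU sU]] := @ultraFilterLemma nat \oo _.
have PU : ProperFilter U := @ultra_proper _ U UU.
have FU : Filter U by case: PU.
have Dt k : boundary D (phi k (t k)) by have [] := xP k.
have [s [p [v [E [sT Dp acp dp [p0 lv wE vE]]]]]] :=
  limit_path UU C0 L0 bL (@boundary_closed _ D) cw wt Dt.
exists p, s; split => //; apply/eqP; rewrite eq_le m_le// andbT.
rewrite /J /action asboolT//.
(* The limit control is one competitor in the action; lower semicontinuity bounds its cost by the
   limits [E] of the energies. *)
apply: (@le_trans _ _ (control_cost s v + (eps * initial_cost x0 Sigma (p 0))%:E)%E).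
  rewrite leeD2r//; apply: ereal_inf_lbound; exists v => //; split.
    by move=> i; have [mv _] := lv i; exact: measurable_funS mv.
  have aeF := ae_filter_ringOfSetsType (@lebesgue_measure R).
  move: dp; apply: filterS => z dz; rewrite in_itv/= => zs.
  by apply/is_derive_tangent; exact: dz.
apply: (@le_trans _ _ (2^-1 * \sum_i E i + eps * initial_cost x0 Sigma (p 0))%:E).
  by rewrite EFinD leeD2r//; exact: control_cost_le.
rewrite -/m m0E lee_fin.
have cJ : 2^-1 * (\sum_i En k i) + eps * initial_cost x0 Sigma (phi k 0) @[k --> U]
    --> 2^-1 * (\sum_i E i) + eps * initial_cost x0 Sigma (p 0).
  apply: cvgD; apply: cvgM; try exact: (@cvg_cst _ _ _ U FU).
    exact: (@cvg_sum_seq R nat U _ _ (fun i k => En k i)).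
  exact: cvg_initial_cost.
have cm : m0 + k.+1%:R^-1 @[k --> U] --> m0 + 0.
  apply: cvgD; first exact: (@cvg_cst _ _ _ U FU).
  have := @cvg_harmonic R; apply: cvg_trans.
  by move=> A /sU.
rewrite -[m0]addr0; apply: (filter_ler_cvg PU cJ cm).
by apply: nearW => k; exact: ltW.
Qed.

Theorem theorem1 (R : realType) (n : nat) (eps T : R)
    (b : 'cV[R]_n -> 'cV[R]_n) (sigma Sigma : 'M[R]_n) (x0 : 'cV[R]_n)
    (D : set 'cV[R]_n)
    (eps_gt0 : 0 < eps) (T_gt0 : 0 < T) (b_lip : lipschitz b)
    (Sigma_posdef : posdef Sigma) (D_compact : compact D) :
  [/\ (forall y : 'cV[R]_n,
         is_argmin (Gam b sigma T D x0 Sigma eps) y <->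
         is_argmax (low_noise_posterior b sigma T D
                      (gaussian_density x0 Sigma) eps) y),
      (forall (phi : R -> 'cV[R]_n) (t : R),
         most_probable_path b sigma T D x0 Sigma eps phi t <->
         attains_minimal_J b sigma T D x0 Sigma eps phi t)
    & (boundary D !=set0 ->
       exists (phi : R -> 'cV[R]_n) (t : R),
         attains_minimal_J b sigma T D x0 Sigma eps phi t)].
Proof.
split.
- move=> y; split=> opt z.
    by rewrite low_noise_posterior_le//; exact: opt.
  by rewrite -low_noise_posterior_le//; exact: opt.
- by move=> phi t; exact: most_probable_path_attains.
- exact: minimal_J_attained.
Qed.
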